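(* Let $c\colon S^1=\mathbf{R}/2\pi\mathbf{Z}\to\mathbf{R}^n$ be an absolutely continuous function such that $c'$ is square integrable. Then for any $s\in\mathbf{R}$, $$\int |c(t+s)-c(t)|^2\,dt \;\le\; \lambda^2(s)\int |c'(t)|^2\,dt,$$ where $\lambda(s)=2\sin\frac{s}{2}$. Equality holds if and only if $s$ is an integral multiple of $2\pi$ or $$c(t)=a_0+(\cos t)\,a+(\sin t)\,b$$ for some vectors $a_0,a,b\in\mathbf{R}^n$.
   Context: Integrals are over $S^1=\mathbf{R}/2\pi\mathbf{Z}$ (one period), and $|\cdot|$ is the Euclidean norm on $\mathbf{R}^n$. The vectors $a,b$ are allowed to be zero or linearly dependent. *)

(* Defs.v *)
From HB Require Import structures.
From mathcomp Require Import all_boot all_order all_algebra.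
From mathcomp Require Import all_classical all_reals all_analysis.

Set Implicit Arguments.
Unset Strict Implicit.
Unset Printing Implicit Defensive.

Import Order.TTheory GRing.Theory Num.Theory.
Import numFieldNormedType.Exports.

Local Open Scope classical_set_scope.
Local Open Scope ring_scope.

(* The norm [`|v|] of the library on ['rV[R]_n] is the sup norm. *)
Definition enorm (R : realType) (n : nat) (v : 'rV[R]_n) : R :=
  Num.sqrt (\sum_(i < n) v 0 i ^+ 2).

Definition abs_continuous (R : realType) (n : nat) (u v : R)
    (f : R -> 'rV[R]_n) : Prop :=
  forall e : R, 0 < e -> exists2 d : R, 0 < d &
    forall (N : nat) (a b : 'I_N -> R),
      (forall i, u <= a i /\ a i < b i /\ b i <= v) ->
      trivIset [set: 'I_N] (fun i => `]a i, b i[%classic) ->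
      \sum_(i < N) (b i - a i) < d ->
      \sum_(i < N) enorm (f (b i) - f (a i)) < e.

(* A function on the circle R/2piZ is a 2pi-periodic function on R, and a
   periodic function is absolutely continuous on the circle exactly when it is
   so on one closed period. *)
Definition circle_abs_continuous (R : realType) (n : nat)
    (c : R -> 'rV[R]_n) : Prop :=
  periodic c (2 * pi) /\ abs_continuous 0 (2 * pi) c.

Definition one_period (R : realType) : set R := `[0, 2 * pi]%classic.
Arguments one_period : clear implicits.

(* For absolutely continuous [c], [derive1 c t] is the derivative at almost
   every [t]; at the other points it is a fixed default vector, which affects
   no integral. Measurability of [derive1 c] needs no separate clause: it holds
   for every continuous [c]. *)
Definition deriv_square_integrable (R : realType) (n : nat)
    (c : R -> 'rV[R]_n) : Prop :=
  (@lebesgue_measure R).-integrable (one_period R)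
    (fun t => (enorm (derive1 c t) ^+ 2)%:E).

Definition lam (R : realType) (s : R) : R := 2 * sin (s / 2).

(* Main.v *)
Require Import Defs.
From HB Require Import structures.
From mathcomp Require Import all_boot all_order all_algebra.
From mathcomp Require Import all_classical all_reals all_analysis.
From mathcomp Require Import measurable_realfun ring lra.

(** In terms of the Fourier coefficients of a coordinate of [c], the [k]-th
    frequency contributes [4 sin^2 (k s / 2)] times its energy to the left-hand
    side, and [k^2] times its energy to the integral of [|c'|^2]. Since
    [|sin (k x)| <= k |sin x|], strictly so for [k >= 2] unless [sin x = 0], the
    inequality follows term by term, and equality leaves only the frequencies 0
    and 1. Completeness of the trigonometric system enters through uniform
    convergence of Fejer means of [c] and of [t |-> c (t + s) - c t]; for [c']
    Bessel's inequality suffices. The coefficients of [c'] are obtained by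
    integration by parts, that is, from the fundamental theorem of calculus for
    the absolutely continuous functions [c cos k] and [c sin k]. *)

Set Implicit Arguments.
Unset Strict Implicit.
Unset Printing Implicit Defensive.

Import Order.TTheory GRing.Theory Num.Theory.
Import numFieldNormedType.Exports.
Local Open Scope classical_set_scope.
Local Open Scope ring_scope.

(** * Absolutely continuous functions are of bounded variation *)

(** The derivative of [c] is merely square integrable, so its Fejer means need not converge
    uniformly, and the two sides are treated unequally. With [D t = c (t + s) - c t], Parseval
    bounds the integral of [D ^ 2] from above, Bessel bounds that of the squared derivative from
    below, and the comparison of coefficients sits in between. Passing to the limit could blur a
    strict inequality: in the case of equality, a nonzero coefficient at a frequency [j >= 2] leaves
    a fixed gap, and the error allowed in Parseval is chosen below it. The final formula for [c] is
    then read off from the Fejer means, which avoids pointwise convergence of Fourier series. Almost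
    everywhere differentiability is itself derived: an absolutely continuous function is a
    difference of two nondecreasing ones whose Stieltjes measures have densities, and indefinite
    integrals of densities can be differentiated almost everywhere. *)

Definition ac_modulus (R : realType) (a b : R) (f : R -> R) (e d : R) : Prop :=
  forall (I : finType) (u v : I -> R),
    (forall i, a <= u i /\ u i <= v i /\ v i <= b) ->
    trivIset [set: I] (fun i => `]u i, v i[%classic) ->
    \sum_i (v i - u i) < d -> \sum_i `|f (v i) - f (u i)| < e.

(** Scalar form of [abs_continuous] with any finite index type and possibly degenerate intervals, so
    that refined families (indexed by dependent pairs) and clamped intervals are admissible as they
    come. *)
Definition ac_on (R : realType) (a b : R) (f : R -> R) : Prop :=
  forall e : R, 0 < e -> exists2 d : R, 0 < d & ac_modulus a b f e d.

Lemma sum_sig (V : nmodType) (I : finType) (J : I -> finType)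
    (F : forall i, J i -> V) :
  \sum_i \sum_(j : J i) F i j = \sum_(p : {i : I & J i}) F (tag p) (tagged p).
Proof.
exact: (@sig_big_dep V 0 +%R I J xpredT (fun i => xpredT) F).
Qed.

(** The pieces of all the partitions, indexed by pairs (interval, piece), form one disjoint family
    of the same total length, to which the modulus applies. *)
Lemma ac_on_variation (R : realType) (a b : R) (f : R -> R) (e d : R) (I : finType)
    (u v : I -> R) (s : I -> seq R) :
  ac_modulus a b f e d ->
  (forall i, a <= u i /\ u i <= v i /\ v i <= b) ->
  trivIset [set: I] (fun i => `]u i, v i[%classic) ->
  \sum_i (v i - u i) < d ->
  (forall i, itv_partition (u i) (v i) (s i)) ->
  \sum_i variation (u i) (v i) f (s i) < e.
Proof.
move=> H uv tI sd ps.
pose p i n := nth (v i) (u i :: s i) n.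
have pmono i m n : (m <= n)%N -> (n <= size (s i))%N -> p i m <= p i n.
  move=> mn ns; have [pth _] := ps i.
  rewrite /p; apply: (@sorted_leq_nth _ <=%R) => //; first exact: le_trans.
  - by rewrite /=; apply: sub_path pth => x y; exact: ltW.
  - by rewrite inE /= ltnS (leq_trans mn).
pose J := {i : I & 'I_(size (s i))}.
pose U (j : J) := p (tag j) (tagged j).
pose V (j : J) := p (tag j) (tagged j).+1.
have up i m : (m <= size (s i))%N -> u i <= p i m.
  by move=> ms; apply: itv_partition_nth_ge; rewrite ?ltnS.
have pv i m : (m <= size (s i))%N -> p i m <= v i.
  by move=> ms; apply: itv_partition_nth_le; rewrite ?ltnS.
have -> : \sum_i variation (u i) (v i) f (s i) = \sum_j `|f (V j) - f (U j)|.
  rewrite -(sum_sig (fun i (j : 'I_(size (s i))) => `|f (p i j.+1) - f (p i j)|)) /=.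
  by apply: eq_bigr => i _; rewrite /variation big_mkord.
apply: H.
- move=> [i j]; rewrite /U /V /=; have [au [_ vb]] := uv i.
  split; first by rewrite (le_trans au)// up// ltnW.
  by split; [exact: pmono|rewrite (le_trans _ vb)// pv].
- move=> [i j] [i' j'] _ _ [x [/=]]; rewrite /U /V /= !in_itv /=.
  move=> /andP[x1 x2] /andP[x3 x4].
  have ii' : i = i'.
    apply: tI => //; exists x; split => /=; rewrite in_itv /=; apply/andP; split.
    + by apply: le_lt_trans x1; apply: up; exact: ltnW.
    + by apply: lt_le_trans x2 _; apply: pv.
    + by apply: le_lt_trans x3; apply: up; exact: ltnW.
    + by apply: lt_le_trans x4 _; apply: pv.
  subst i'; congr Tagged; apply/val_inj => /=.
  case: (ltngtP j j') => // jj'.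
  + have := pmono i _ _ jj' (ltnW (ltn_ord j')).
    by rewrite leNgt (lt_trans x3 x2).
  + have := pmono i _ _ jj' (ltnW (ltn_ord j)).
    by rewrite leNgt (lt_trans x1 x4).
- apply: le_lt_trans sd.
  rewrite -(sum_sig (fun i (j : 'I_(size (s i))) => p i j.+1 - p i j)) /=.
  apply: ler_sum => i _.
  rewrite -(big_mkord xpredT (fun n => p i n.+1 - p i n)) telescope_sumr//.
  by rewrite /p (itv_partition_nth_size _ (ps i)).
Qed.

Lemma ac_on_total_variation (R : realType) (a b : R) (f : R -> R) (e d : R)
    (I : finType) (u v : I -> R) :
  ac_modulus a b f e d ->
  (forall i, a <= u i /\ u i <= v i /\ v i <= b) ->
  trivIset [set: I] (fun i => `]u i, v i[%classic) ->
  \sum_i (v i - u i) < d ->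
  (forall i, total_variation (u i) (v i) f \is a fin_num) ->
  \sum_i fine (total_variation (u i) (v i) f) <= e.
Proof.
move=> H uv tI sd fTV; apply/ler_addgt0Pr => eta eta0.
(* Each interval may lose [eta / k], at most [eta] altogether; the successor keeps [k] positive when
   [I] is empty. *)
pose k : R := (#|I|.+1)%:R; have k0 : 0 < k by rewrite ltr0n.
have ek : 0 < eta / k by rewrite divr_gt0.
have /choice[s sP] i : exists s, itv_partition (u i) (v i) s /\
    fine (total_variation (u i) (v i) f) - eta / k < variation (u i) (v i) f s.
  have [x [y [s ps <-] <-] xlt] := ub_ereal_sup_adherent ek (fTV i).
  exists s; split => //; rewrite -lte_fin EFinB fineK//.
have := ac_on_variation H uv tI sd (fun i => (proj1 (sP i))).
move=> /ltW le_e; rewrite -lerBlDr; apply: le_trans le_e.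
apply: (@le_trans _ _ (\sum_i (fine (total_variation (u i) (v i) f) - eta / k))).
  rewrite sumrB lerD2l lerN2 sumr_const -mulr_natl -/k mulrCA.
  rewrite -[leRHS]mulr1 ler_wpM2l ?(ltW eta0)//.
  by rewrite ler_pdivrMr// mul1r ler_nat.
by apply: ler_sum => i _; exact/ltW/(proj2 (sP i)).
Qed.

(** On an interval shorter than the [d] that belongs to [e = 1] every variation is at most 1;
    finitely many steps of length [d / 2] exhaust [[a, b]], and variations over adjacent intervals
    add up. *)
Lemma ac_on_bounded_variation (R : realType) (a b : R) (f : R -> R) :
  a <= b -> ac_on a b f -> bounded_variation a b f.
Proof.
move=> ab acf; have [d d0 H] := acf 1 ltr01.
have bvd x y : a <= x -> x <= y -> y <= b -> y - x < d -> bounded_variation x y f.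
  move=> ax xy yb yx; exists 1 => _ [s ps <-].
  have := @ac_on_variation _ a b f 1 d unit (fun=> x) (fun=> y) (fun=> s) H.
  rewrite !(big_const, card_unit) /= !addr0 => /(_ _ _ yx (fun=> ps)) h.
  by apply/ltW/h => // -[] [].
suff BV n x : a <= x -> x <= b -> x - a <= n%:R * (d / 2) -> bounded_variation a x f.
  have [n hn] : exists n : nat, b - a <= n%:R * (d / 2).
    exists (Num.bound ((b - a) / (d / 2))).
    rewrite -ler_pdivrMr ?divr_gt0//; apply/ltW.
    by apply: archi_boundP; rewrite divr_ge0 ?subr_ge0// divr_ge0 // ltW.
  exact: (BV n).
elim: n x => [|n IH] x ax xb.
  rewrite mul0r subr_le0 => xa.
  by rewrite (@le_anti _ _ x a) ?ax ?xa//; exact: bounded_variationxx.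
move=> hx; have [xd|dx] := ltP (x - a) d; first exact: bvd.
pose y := x - d / 2.
have ay : a <= y by rewrite /y; lra.
have yx : y <= x by rewrite /y; lra.
have bay : bounded_variation a y f.
  apply: IH => //; first exact: le_trans xb.
  by move: hx; rewrite -natr1 mulrDl mul1r /y; lra.
have byx : bounded_variation y x f by apply: bvd => //; rewrite /y; lra.
apply/bounded_variationP => //; rewrite (total_variationD _ ay yx).
by rewrite fin_numD; apply/andP; split; apply/bounded_variationP.
Qed.

(* Refining each interval of a disjoint family by a partition that nearly attains the
   variation turns the modulus of [f] into one of its variation function. *)
Lemma ac_on_fine_total_variation (R : realType) (a b : R) (f : R -> R) :
  a <= b -> ac_on a b f -> ac_on a b (fun x => fine (total_variation a x f)).
Proof.
move=> ab acf e e0; have e20 : 0 < e / 2 by rewrite divr_gt0.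
have [d d0 H] := acf _ e20; exists d => // I u v uv tI sd.
have bv := ac_on_bounded_variation ab acf.
have fin x y : a <= x -> x <= y -> y <= b -> total_variation x y f \is a fin_num.
  move=> ax xy yb; apply/bounded_variationP => //.
  apply: (@bounded_variationr _ a) => //.
  by apply: (@bounded_variationl _ _ _ b) => //; exact: le_trans xy.
rewrite (eq_bigr (fun i => fine (total_variation (u i) (v i) f))); last first.
  move=> i _; have [au [uvi vb]] := uv i.
  rewrite (total_variationD f au uvi) fineD ?fin//; last lra.
  by rewrite addrAC subrr add0r ger0_norm// fine_ge0// total_variation_ge0.
apply: le_lt_trans (ac_on_total_variation H uv tI sd _) _; last lra.
by move=> i; have [? []] := uv i; exact: fin.
Qed.

Lemma ac_onB (R : realType) (a b : R) (f g : R -> R) :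
  ac_on a b f -> ac_on a b g -> ac_on a b (fun x => f x - g x).
Proof.
move=> acf acg e e0; have e20 : 0 < e / 2 by rewrite divr_gt0.
have [d1 d10 H1] := acf _ e20; have [d2 d20 H2] := acg _ e20.
exists (Num.min d1 d2) => [|I u v uv tI]; first by rewrite lt_min d10.
rewrite lt_min => /andP[/(H1 _ _ _ uv tI) h1 /(H2 _ _ _ uv tI) h2].
apply: (@le_lt_trans _ _ (\sum_i `|f (v i) - f (u i)| + \sum_i `|g (v i) - g (u i)|)).
  rewrite -big_split; apply: ler_sum => i _ /=.
  rewrite [X in `|X|](_ : _ = f (v i) - f (u i) - (g (v i) - g (u i))); last by ring.
  exact: ler_normB.
lra.
Qed.

Lemma ac_on_uniform_continuous (R : realType) (a b : R) (f : R -> R) (e : R) :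
  ac_on a b f -> 0 < e -> exists2 d : R, 0 < d & forall x y, a <= x <= b -> a <= y <= b ->
    `|y - x| < d -> `|f y - f x| < e.
Proof.
move=> acf e0; have [d d0 H] := acf _ e0; exists d => //.
suff S x y : a <= x -> y <= b -> x <= y -> y - x < d -> `|f y - f x| < e.
  move=> x y /andP[ax xb] /andP[ay yb]; have [xy|/ltW yx] := leP x y.
    by rewrite ger0_norm ?subr_ge0//; exact: S.
  by rewrite distrC ger0_norm ?subr_ge0// distrC; exact: S.
move=> ax yb xy yxd; have := H unit (fun=> x) (fun=> y).
rewrite !(big_const, card_unit) /= !addr0; apply => //.
by move=> [] [].
Qed.

(** * Projection onto a segment *)

Section clamp.
Context {R : realType}.
Variables a b : R.
Hypothesis ab : a <= b.

(** Serves to extend a function on [[a, b]] by constants to the whole line, where a Stieltjes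
    measure needs it. *)
Definition clamp (x : R) : R := Num.min b (Num.max a x).

Lemma clamp_in x : a <= clamp x <= b.
Proof. by rewrite /clamp le_min ge_min lexx ab le_max lexx. Qed.

Lemma clamp_id x : a <= x <= b -> clamp x = x.
Proof. by move=> /andP[ax xb]; rewrite /clamp (max_idPr ax) (min_idPr xb). Qed.

Lemma le_clamp x y : x <= y -> clamp x <= clamp y.
Proof.
move=> xy; rewrite /clamp le_min !ge_min lexx /= ge_max !le_max lexx xy /=.
by rewrite !orbT.
Qed.

(** Together with [lt_clamp]: an open interval with clamped endpoints lies inside the original one,
    so clamping preserves disjointness. *)
Lemma clamp_lt x y : clamp x < y -> y <= b -> x < y.
Proof.
rewrite /clamp gt_min gt_max => /orP[by_ yb|/andP[]//].
by move: by_; rewrite ltNge yb.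
Qed.

Lemma lt_clamp x y : x < clamp y -> a <= x -> x < y.
Proof.
rewrite /clamp lt_min lt_max => /andP[_ /orP[xa ax|//]].
by move: xa; rewrite ltNge ax.
Qed.

Lemma clamp_lipschitz x y : x <= y -> clamp y - clamp x <= y - x.
Proof. by move=> xy; rewrite /clamp; case: (ltP a x) => ?; case: (ltP a y) => ?;
  do ?[case: (ltP b) => ?]; lra. Qed.

End clamp.

(** * The fundamental theorem of calculus for absolutely continuous functions *)

Section ac_nondecreasing.
Context {R : realType}.
Variables (a b : R) (P : R -> R).
Hypotheses (ab : a <= b) (acP : ac_on a b P)
  (ndP : forall x y, a <= x -> x <= y -> y <= b -> P x <= P y).

Let F (x : R) := P (clamp a b x).

Let F_nd : {homo F : x y / x <= y}.
Proof.
move=> x y xy; have /andP[? ?] := clamp_in ab x; have /andP[? ?] := clamp_in ab y.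
by apply: ndP => //; exact: le_clamp.
Qed.

Let F_rc : right_continuous F.
Proof.
move=> x; apply/cvgrPdist_lt => e e0.
have [d d0 H] := ac_on_uniform_continuous acP e0.
near=> y; rewrite distrC; apply: H; rewrite ?clamp_in//.
have xy : x <= y by near: y; exact: nbhs_right_ge.
rewrite ger0_norm ?subr_ge0 ?le_clamp//.
apply: le_lt_trans (clamp_lipschitz a b xy) _.
rewrite ltrBlDr; near: y; apply: nbhs_right_lt; lra.
Unshelve. all: by end_near. Qed.

HB.instance Definition _ := isCumulative.Build R _ R F F_nd F_rc.

Notation mu := (@lebesgue_measure R).
Let nu := lebesgue_stieltjes_measure F.

Let nu_oc (x y : R) : x <= y -> nu `]x, y]%classic = (F y - F x)%:E.
Proof.
move=> xy; rewrite /nu /lebesgue_stieltjes_measure /measure_extension.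
rewrite measurable_mu_extE/=; last exact: is_ocitv.
by rewrite wlength_itv_bnd// EFinB.
Qed.

(* By outer regularity a null set has open neighbourhoods of small measure; absolute
   continuity applies to finitely many of their component intervals. *)
Let nu_null A : measurable A -> A `<=` `]a, b]%classic -> mu A = 0%E -> nu A = 0%E.
Proof.
move=> mA Aab muA; apply/eqP; rewrite eq_le measure_ge0 andbT.
apply/lee_addgt0Pr => e e0; rewrite add0e.
have [d d0 H] := acP e0.
have muAoo : (mu A < +oo)%E by rewrite muA ltry.
have [U0 [oU0 AU0 muU0]] := lebesgue_regularity_outer mA muAoo d0.
(* Boundedness of [U] makes each of its components an interval []inf, sup[] with real endpoints. *)
pose U := U0 `&` `]a - 1, b + 1[%classic.
have oU : open U by apply: openI => //; exact: interval_open.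
have AU : A `<=` U.
  move=> x Ax; split; first exact: AU0.
  have := Aab _ Ax; rewrite /= !in_itv /= => /andP[? ?]; apply/andP; split; lra.
have mU : measurable U by exact: open_measurable.
have muU : (mu U < d%:E)%E.
  apply: le_lt_trans muU0; rewrite -[leRHS]adde0 -[X in (_ + X)%E]muA.
  apply: le_trans (measureU2 _ _ _) => //; last first.
    by apply: measurableD => //; exact: open_measurable.
  apply: le_measure; rewrite ?inE//.
    apply: measurableU => //; apply: measurableD => //.
    exact: open_measurable.
  by move=> x [U0x _]; have [Ax|nAx] := pselect (A x); [right|left].
pose J := open_disjoint_itv oU.
have oJ i : open (J i) by exact: open_disjoint_itv_open.
have mJ i : measurable (J i) by exact: open_measurable.
have tJ : trivIset setT J by exact: open_disjoint_itv_trivIset.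
have UJ : U = \bigcup_i J i by exact: open_disjoint_itv_bigcup.
have JU i : J i `<=` `]a - 1, b + 1[%classic.
  by move=> x Jx; have : U x by [rewrite UJ; exists i]; case.
pose u i := inf (J i); pose v i := sup (J i).
have JE i : J i = `]u i, v i[%classic.
  have {1}<- : (J i)^° = J i by exact/interior_id.
  rewrite interval_bounded_interior; first by apply/seteqP; split => x /=; rewrite in_itv.
  - exact: open_disjoint_itv_is_interval.
  - by exists (a - 1) => x /JU /=; rewrite in_itv /= => /andP[/ltW].
  - by exists (b + 1) => x /JU /=; rewrite in_itv /= => /andP[_ /ltW].
have uv i : u i <= v i.
  have [E|/set0P[x Jx]] := eqVneq (J i) set0; first by rewrite /u /v E inf0 sup0.
  by have := Jx; rewrite {1}JE /= in_itv /= => /andP[p1 p2]; exact/ltW/(lt_trans p1).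
have nuJ i : (nu (J i) <= (F (v i) - F (u i))%:E)%E.
  rewrite -nu_oc// JE; apply: le_measure; rewrite ?inE//; last first.
    by apply: subset_itvl; rewrite bnd_simp.
have muJ i : mu (J i) = (v i - u i)%:E.
  rewrite JE lebesgue_measure_itv/= lte_fin; case: ltP => // vu.
  by rewrite (@le_anti _ _ (v i) (u i)) ?uv ?vu// subrr.
apply: (@le_trans _ _ (nu U)); first by apply: le_measure; rewrite ?inE.
rewrite UJ.
have -> : nu (\bigcup_i J i) = (\sum_(0 <= i <oo | i \in setT) nu (J i))%E.
  apply: (@measure_bigcup _ _ _ (lebesgue_stieltjes_measure F) setT J (fun i _ => mJ i) tJ).
(* The modulus controls finite families only, so the bound is proved for partial sums and passed to
   the limit. *)
apply: lime_le; first by apply: is_cvg_nneseries => *; exact: measure_ge0.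
near=> n; rewrite big_mkord.
rewrite (eq_bigl xpredT); last by move=> i; rewrite in_setT.
apply: (@le_trans _ _ (\sum_(i < n) (F (v i) - F (u i))%:E)%E).
  by apply: lee_sum => i _.
rewrite sumEFin lee_fin; apply/ltW.
apply: (@le_lt_trans _ _ (\sum_(i < n) `|F (v i) - F (u i)|)).
  by apply: ler_sum => i _; exact: ler_norm.
(* Components may stick out of [[a, b]]. Clamping their endpoints does not change the increments of
   [F], which is [P] after [clamp], and does not lengthen the intervals. *)
apply: (H _ (fun i : 'I_n => clamp a b (u i)) (fun i : 'I_n => clamp a b (v i))).
- move=> i; have /andP[? ?] := clamp_in ab (u i); have /andP[? ?] := clamp_in ab (v i).
  by split => //; split => //; exact: le_clamp.
- move=> i j _ _ [x [/= ]]; rewrite !in_itv /= => /andP[ux xv] /andP[ux' xv'].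
  apply/val_inj/tJ => //; exists x; split; rewrite JE /= in_itv /=; apply/andP.
  + have /andP[? ?] := clamp_in ab (u i); have /andP[? ?] := clamp_in ab (v i).
    split; first by apply: (@clamp_lt _ a b); lra.
    by apply: (@lt_clamp _ a b); lra.
  + have /andP[? ?] := clamp_in ab (u j); have /andP[? ?] := clamp_in ab (v j).
    split; first by apply: (@clamp_lt _ a b); lra.
    by apply: (@lt_clamp _ a b); lra.
- apply: (@le_lt_trans _ _ (\sum_(i < n) (v i - u i))).
    by apply: ler_sum => i _; exact: clamp_lipschitz.
  rewrite -lte_fin -sumEFin; apply: le_lt_trans muU.
  rewrite UJ measure_bigcup; [|by move=> i _; exact: mJ|exact: tJ].
  rewrite (eq_bigr (fun i : 'I_n => mu (J i))); last by move=> i _; rewrite muJ.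
  rewrite -(big_mkord xpredT (fun i => mu (J i))).
  rewrite (@eq_eseriesl _ _ xpredT); [exact: nneseries_lim_ge|by move=> i; rewrite in_setT].
Unshelve. all: by end_near. Qed.

Let nu_D_lty : (nu `]a, b]%classic < +oo)%E.
Proof. by rewrite nu_oc// ltry. Qed.

Let mD : measurable (`]a, b]%classic : set (measurableTypeR R)).
Proof. exact: measurable_itv. Qed.

Let nuD : {finite_measure set (measurableTypeR R) -> \bar R} := mfrestr mD nu_D_lty.

Lemma ac_nondecreasing_density : exists g : R -> R,
  mu.-integrable setT (EFin \o g) /\
  forall x, a <= x <= b -> \int[mu]_(t in `]a, x]) g t = P x - P a.
Proof.
have dom : nuD `<< mu.
  apply/null_content_dominatesP => A mA muA.
  rewrite /nuD /mfrestr /mrestr; apply: nu_null.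
  - by apply: measurableI => //; exact: measurable_itv.
  - by move=> x [].
  - by apply: (subset_measure0 (B := A)) => //; apply: measurableI => //; exact: measurable_itv.
have [f [f0 ffin intf fE]] := @radon_nikodym_sigma_finite _ _ _ mu nuD dom.
exists (fine \o f); split.
  by apply: eq_integrable intf => // x _ /=; rewrite fineK.
move=> x /andP[ax xb].
rewrite /Rintegral (eq_integral f); last by move=> t _; rewrite /= fineK.
rewrite -fE; last exact: measurable_itv.
have -> : nuD `]a, x]%classic = nu `]a, x]%classic.
  congr (nu _); apply/setIidl => t /=; rewrite !in_itv /= => /andP[-> tx] /=.
  exact: le_trans xb.
by rewrite nu_oc//= /F !clamp_id// ?ax// lexx.
Qed.

End ac_nondecreasing.

(** * Almost everywhere differentiability and the integral of the derivative *)

Section ac_derivative.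
Context {R : realType}.
Variables (a b : R) (f : R -> R).
Hypotheses (ab : a < b) (acf : ac_on a b f).
Notation mu := (@lebesgue_measure R).

(* Radon-Nikodym applied to the Stieltjes measures of the two nondecreasing functions [V]
   and [V - f], where [V] is the variation function of [f]. *)
Lemma ac_density : exists g : R -> R,
  mu.-integrable setT (EFin \o g) /\
  forall x, a <= x <= b -> \int[mu]_(t in `]a, x]) g t = f x - f a.
Proof.
have ableq := ltW ab; have bv := ac_on_bounded_variation ableq acf.
pose V x := fine (total_variation a x f).
have fin x y : a <= x -> x <= y -> y <= b -> total_variation x y f \is a fin_num.
  move=> ax xy yb; apply/bounded_variationP => //.
  apply: (@bounded_variationr _ a) => //.
  by apply: (@bounded_variationl _ _ _ b) => //; exact: le_trans xy.
have VB x y : a <= x -> x <= y -> y <= b -> V y - V x = fine (total_variation x y f).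
  move=> ax xy yb; rewrite /V (total_variationD f ax xy) fineD ?fin//; last lra.
  by rewrite addrAC subrr add0r.
have [g1 [ig1 g1E]] : exists g : R -> R, mu.-integrable setT (EFin \o g) /\
    forall x, a <= x <= b -> \int[mu]_(t in `]a, x]) g t = V x - V a.
  apply: ac_nondecreasing_density => //; first exact: ac_on_fine_total_variation.
  move=> x y ax xy yb; rewrite -subr_ge0 VB//.
  by rewrite fine_ge0// total_variation_ge0.
have [g2 [ig2 g2E]] : exists g : R -> R, mu.-integrable setT (EFin \o g) /\
    forall x, a <= x <= b ->
      \int[mu]_(t in `]a, x]) g t = (V x - f x) - (V a - f a).
  apply: (ac_nondecreasing_density (P := fun x => V x - f x)) => //.
    by apply: ac_onB => //; exact: ac_on_fine_total_variation.
  move=> x y ax xy yb; have := VB _ _ ax xy yb.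
  have : `|f y - f x| <= fine (total_variation x y f).
    by rewrite -lee_fin fineK ?fin// total_variation_ge.
  by move=> /(le_trans (ler_norm _)); lra.
exists (fun x => g1 x - g2 x); split.
  exact: (integrableB _ ig1 ig2).
move=> x xab; rewrite RintegralB//=.
- by rewrite g1E// g2E//; ring.
- exact: (integrableS measurableT).
- exact: (integrableS measurableT).
Qed.

(** [FTC1Ny] differentiates integrals that start at minus infinity. The density is therefore cut off
    to zero outside []a, b]]; near an interior point, [f] is the integral of the result plus the
    constant [f a]. *)
Lemma ac_derivative : exists g : R -> R, [/\
  mu.-integrable `[a, b]%classic (EFin \o g),
  \int[mu]_(t in `[a, b]) g t = f b - f a &
  {ae mu, forall x, a < x < b -> derivable f x 1 /\ derive1 f x = g x}].
Proof.
have [g [ig gE]] := ac_density; exists g; split.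
- exact: (integrableS measurableT).
- rewrite -gE ?lexx ?(ltW ab)//.
  rewrite /Rintegral; congr fine; apply/esym/integral_itv_obnd_cbnd.
  by apply: (measurable_int mu); exact: (integrableS measurableT).
pose D := `]a, b]%classic : set R.
have mD : measurable D by exact: measurable_itv.
have igD : mu.-integrable D (EFin \o g) by exact: (integrableS measurableT).
have locg : locally_integrable [set: R] (g \_ D) by exact: integrable_locally.
have igDT : mu.-integrable setT (EFin \o (g \_ D)).
  by rewrite -restrict_EFin; have h := @integrable_mkcond _ _ R mu D (EFin \o g) mD; apply h.
have igy y : mu.-integrable `]-oo, y]%classic (EFin \o (g \_ D)).
  exact: (integrableS measurableT).
have := FTC1Ny igy locg.
apply: filterS; first exact: (ae_filter_ringOfSetsType mu).
move=> x /= + /andP[ax xb].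
set G := (fun y : R => \int[mu]_(t in `]-oo, y]) (g \_ D) t).
have GE : \forall y \near x, f y = G y + f a.
  near=> y; have axy : a <= y <= b.
    by apply/andP; split; apply/ltW; near: y; [exact: lt_nbhsr|exact: lt_nbhsl].
  rewrite -[f y](subrK (f a)) -gE// /G /Rintegral; congr (fine _ + _).
  transitivity (\int[mu]_(t in `]-oo, y]%classic `&` D) (g t)%:E)%E; last first.
    by rewrite integral_mkcondr; apply: eq_integral => t _; rewrite !patchE; case: ifP.
  congr (integral _ _ _).
  apply/seteqP; split => t /=; rewrite /D /= !in_itv /=.
    by move=> /andP[-> ty]; rewrite ty/= (le_trans ty)//; case/andP: axy.
  by move=> [-> /andP[->]].
move=> [dG GD].
have dGx : is_derive x 1 G (g x).
  have <- : derive1 G x = g x.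
    by rewrite GD patchE mem_set//= /D /= in_itv /= ax ltW.
  by rewrite derive1E; exact/derivableP.
have H : is_derive x 1 f (g x).
  have := is_deriveD dGx (is_derive_cst (f a) x 1); rewrite addr0.
  apply: near_eq_is_derive; near=> y; apply/esym; near: y; exact: GE.
by split; [exact: ex_derive|rewrite derive1E derive_val].
Unshelve. all: by end_near. Qed.

End ac_derivative.

(** * Integration over the circle and the trigonometric system *)

Section continuous_functions.
Context {R : realType}.
Implicit Types f g : R -> R.

Lemma continuous_fun_cst (r : R) : continuous (fun _ : R => r).
Proof. by move=> x; exact: cvg_cst. Qed.

Lemma continuous_funD f g : continuous f -> continuous g -> continuous (fun x => f x + g x).
Proof. by move=> cf cg x; apply: cvgD; [exact: cf|exact: cg]. Qed.

Lemma continuous_funB f g : continuous f -> continuous g -> continuous (fun x => f x - g x).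
Proof. by move=> cf cg x; apply: cvgB; [exact: cf|exact: cg]. Qed.

Lemma continuous_funM f g : continuous f -> continuous g -> continuous (fun x => f x * g x).
Proof. by move=> cf cg x; apply: cvgM; [exact: cf|exact: cg]. Qed.

Lemma continuous_funX f n : continuous f -> continuous (fun x => f x ^+ n).
Proof.
move=> cf; elim: n => [|n IH]; first exact: continuous_fun_cst.
under [X in continuous X]eq_fun do rewrite exprS.
exact: continuous_funM.
Qed.

Lemma continuous_fun_sum (I : Type) (s : seq I) (P : pred I) (F : I -> R -> R) :
  (forall i, continuous (F i)) -> continuous (fun x => \sum_(i <- s | P i) F i x).
Proof.
move=> cF; elim: s => [|i s IH].
  by under [X in continuous X]eq_fun do rewrite big_nil; exact: continuous_fun_cst.
under [X in continuous X]eq_fun do rewrite big_cons.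
by case: (P i) => //; exact: continuous_funD.
Qed.

Lemma continuous_affine_comp f (k s : R) :
  continuous f -> continuous (fun x => f (k * x + s)).
Proof.
move=> cf x; apply: (@continuous_comp _ _ _ (fun x => k * x + s) f); last exact: cf.
by apply: cvgD; [apply: cvgM; [exact: cvg_cst|exact: cvg_id]|exact: cvg_cst].
Qed.

Lemma continuous_cosM (k : R) : continuous (fun x : R => cos (k * x)).
Proof.
have := @continuous_affine_comp _ k 0 (@continuous_cos R).
by under [X in continuous X]eq_fun do rewrite addr0.
Qed.

Lemma continuous_sinM (k : R) : continuous (fun x : R => sin (k * x)).
Proof.
have := @continuous_affine_comp _ k 0 (@continuous_sin R).
by under [X in continuous X]eq_fun do rewrite addr0.
Qed.

Lemma continuous_funT f (s : R) : continuous f -> continuous (fun x => f (x + s)).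
Proof.
move=> cf; have := @continuous_affine_comp _ 1 s cf.
by under [X in continuous X]eq_fun do rewrite mul1r.
Qed.

End continuous_functions.

Create HintDb cont.
#[export] Hint Resolve continuous_fun_cst continuous_funD continuous_funB continuous_funM
  continuous_funX continuous_fun_sum continuous_cosM continuous_sinM continuous_funT : cont.

(** * The integral over one period *)

Section circle_integral.
Context {R : realType}.
Notation mu := (@lebesgue_measure R).
Implicit Types f g : R -> R.

Definition circint f : R := \int[mu]_(t in one_period R) f t.
Definition cintegrable f : Prop := mu.-integrable (one_period R) (EFin \o f).

Lemma measurable_one_period : measurable (one_period R).
Proof. exact: measurable_itv. Qed.
Local Hint Resolve measurable_one_period : core.

Lemma twopi_gt0 : 0 < 2 * pi :> R.
Proof. by rewrite mulr_gt0// pi_gt0. Qed.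

Lemma continuous_itv_integrable f (a b : R) :
  continuous f -> mu.-integrable `[a, b]%classic (EFin \o f).
Proof.
move=> cf; apply: continuous_compact_integrable; first exact: segment_compact.
exact: continuous_subspaceT.
Qed.

Lemma continuous_cintegrable f : continuous f -> cintegrable f.
Proof. exact: continuous_itv_integrable. Qed.

Lemma cintegrableD f g : cintegrable f -> cintegrable g -> cintegrable (fun x => f x + g x).
Proof. by move=> cf cg; exact: (integrableD _ cf cg). Qed.

Lemma cintegrableB f g : cintegrable f -> cintegrable g -> cintegrable (fun x => f x - g x).
Proof. by move=> cf cg; exact: (integrableB _ cf cg). Qed.

Lemma cintegrableZ (r : R) f : cintegrable f -> cintegrable (fun x => r * f x).
Proof. by move=> cf; apply: (@integrableZl _ _ _ mu _ _ r _ cf). Qed.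

Lemma cintegrable_sum (I : Type) (s : seq I) (F : I -> R -> R) :
  (forall i, cintegrable (F i)) -> cintegrable (fun x => \sum_(i <- s) F i x).
Proof.
move=> cF; elim: s => [|i s IH].
  rewrite (_ : (fun _ => _) = fun _ => 0); last by apply/funext => x; rewrite big_nil.
  exact/continuous_cintegrable/continuous_fun_cst.
rewrite (_ : (fun _ => _) = fun x => F i x + \sum_(j <- s) F j x).
  exact: cintegrableD.
by apply/funext => x; rewrite big_cons.
Qed.

Lemma circintD f g : cintegrable f -> cintegrable g ->
  circint (fun x => f x + g x) = circint f + circint g.
Proof. by move=> cf cg; exact: RintegralD. Qed.

Lemma circintB f g : cintegrable f -> cintegrable g ->
  circint (fun x => f x - g x) = circint f - circint g.
Proof. by move=> cf cg; exact: RintegralB. Qed.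

Lemma circintZ (r : R) f : cintegrable f -> circint (fun x => r * f x) = r * circint f.
Proof. by move=> cf; exact: RintegralZl. Qed.

Lemma circint_cst (r : R) : circint (fun=> r) = r * (2 * pi).
Proof.
have E : mu `[0, 2 * pi]%classic = (2 * pi)%:E.
  by rewrite lebesgue_measure_itv/= lte_fin twopi_gt0 oppr0 adde0.
by rewrite /circint Rintegral_cst//; congr (_ * _); exact: (congr1 fine E).
Qed.

Lemma circint_sum (I : Type) (s : seq I) (F : I -> R -> R) :
  (forall i, cintegrable (F i)) ->
  circint (fun x => \sum_(i <- s) F i x) = \sum_(i <- s) circint (F i).
Proof.
move=> cF; elim: s => [|i s IH].
  rewrite big_nil (_ : (fun _ => _) = fun _ => 0) ?circint_cst ?mul0r//.
  by apply/funext => x; rewrite big_nil.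
rewrite big_cons -IH -circintD//; last exact: cintegrable_sum.
by congr circint; apply/funext => x; rewrite big_cons.
Qed.

Lemma circint_ge0 f : (forall x, 0 <= f x) -> 0 <= circint f.
Proof. by move=> f0; apply: Rintegral_ge0. Qed.

Lemma le_circint f g : cintegrable f -> cintegrable g ->
  (forall x, f x <= g x) -> circint f <= circint g.
Proof. by move=> cf cg fg; apply: le_Rintegral. Qed.

Lemma le_normr_circint f : cintegrable f -> `|circint f| <= circint (fun x => `|f x|).
Proof. by move=> cf; apply: le_normr_Rintegral. Qed.

Lemma circint_derive (F f : R -> R) : continuous f ->
  (forall x : R, is_derive x (1 : R) F (f x)) -> circint f = F (2 * pi) - F 0.
Proof.
move=> cf dF; have cF : continuous F.
  by move=> x; apply: differentiable_continuous; apply/derivable1_diffP; exact: ex_derive.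
rewrite /circint /Rintegral (@continuous_FTC2 _ f F) ?twopi_gt0//.
- exact: continuous_subspaceT.
- split => //.
  + by apply: cvg_at_right_filter; exact: cF.
  + by apply: cvg_at_left_filter; exact: cF.
- by move=> x _; rewrite derive1E derive_val.
Qed.

End circle_integral.

(** * Translation invariance of the integral over a period *)

Section circle_shift.
Context {R : realType}.
Notation mu := (@lebesgue_measure R).
Implicit Types f g : R -> R.

Lemma periodic_int (V : zmodType) (f : R -> V) (T : R) (k : int) (t : R) :
  periodic f T -> f (t + k%:~R * T) = f t.
Proof.
move=> pf.
have pn (n : nat) u : f (u + n%:R * T) = f u.
  by rewrite mulr_natl periodicn.
case: (intP k) => [|n|n].
- by rewrite mul0r addr0.
- exact: pn.
- by rewrite -[LHS](pn n.+1); congr f; rewrite mulrNz mulNr -pmulrn subrK.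
Qed.

Lemma reduce_modulo (T s : R) : 0 < T ->
  exists k : int, 0 <= s - k%:~R * T < T.
Proof.
move=> T0; exists (Num.floor (s / T)).
have := floor_le_tmp (s / T); have := floorD1_gt (s / T).
set k := Num.floor _; rewrite intrD1 ltr_pdivrMr// ler_pdivlMr// mulrDl mul1r => h1 h2.
by apply/andP; split; lra.
Qed.

Lemma Rintegral_itv_shift f (a b s : R) : a <= b -> continuous f ->
  \int[mu]_(x in `[a, b]) f (x + s) = \int[mu]_(x in `[a + s, b + s]) f x.
Proof.
move=> ab cf; rewrite /Rintegral; congr fine.
have dF (x : R) : is_derive x (1 : R) (fun y : R => y + s) 1.
  by have := is_deriveD (is_derive_id x (1 : R)) (is_derive_cst s x (1 : R)); rewrite addr0.
have F'E : derive1 (fun y : R => y + s) = cst 1.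
  by apply/funext => x; rewrite derive1E derive_val.
have cF : continuous (fun y : R => y + s).
  by move=> x; apply: cvgD; [exact: cvg_id|exact: cvg_cst].
rewrite (@integration_by_substitution_increasing R (fun y => y + s) f a b)//.
- by apply: eq_integral => x _; rewrite F'E /= mulr1.
- by move=> x y _ _; rewrite ltrD2r.
- by rewrite F'E => x _; exact: cvg_cst.
- by rewrite F'E; exact: is_cvg_cst.
- by rewrite F'E; exact: is_cvg_cst.
- split.
  + by move=> x _; exact: ex_derive.
  + by apply: cvg_at_right_filter; exact: cF.
  + by apply: cvg_at_left_filter; exact: cF.
- exact: continuous_subspaceT.
Qed.

Lemma Rintegral_itv_split f (a b c : R) : a <= b -> b <= c -> continuous f ->
  \int[mu]_(x in `[a, c]) f x =
  \int[mu]_(x in `[a, b]) f x + \int[mu]_(x in `[b, c]) f x.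
Proof.
move=> ab bc cf.
have := @Rintegral_itvB R f (BLeft a) (BRight c) b (continuous_itv_integrable _ _ cf).
rewrite !bnd_simp => /(_ ab bc) E.
rewrite -(@Rintegral_itv_obnd_cbnd R b (BRight c)) ?E; first by rewrite -E; ring.
apply: (@integrableS _ _ R mu `[b, c]%classic) => //.
  by apply: subset_itvr; rewrite bnd_simp.
exact: continuous_itv_integrable.
Qed.

(** With [r] the residue of [s] modulo the period, [[r, 2 * pi + r]] is cut at [2 * pi], and the
    piece beyond is moved back to [[0, r]] by periodicity. *)
Lemma circint_shift f (s : R) : continuous f -> periodic f (2 * pi) ->
  circint (fun t => f (t + s)) = circint f.
Proof.
move=> cf pf; have [k /andP[s0 s2]] := reduce_modulo s (@twopi_gt0 R).
set r := s - k%:~R * (2 * pi) in s0 s2.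
have -> : (fun t => f (t + s)) = fun t => f (t + r).
  by apply/funext => t; rewrite -[RHS](periodic_int k _ pf); congr f; rewrite /r; ring.
rewrite /circint /one_period Rintegral_itv_shift//; last exact/ltW/twopi_gt0.
rewrite add0r (@Rintegral_itv_split f r (2 * pi))//; last 2 first.
- exact: ltW.
- by rewrite lerDl.
rewrite (@Rintegral_itv_split f 0 r (2 * pi))//; last exact: ltW.
rewrite addrC; congr (_ + _).
rewrite -{1}[2 * pi]add0r [in X in `[_, X]]addrC -Rintegral_itv_shift//.
by apply: eq_Rintegral => x _; exact: pf.
Qed.

End circle_shift.

(** * Orthogonality relations *)

Section trigonometric_system.
Context {R : realType}.
Implicit Types (k l : nat) (t : R).

Lemma periodic_cosn k : periodic (fun t : R => cos (k%:R * t)) (2 * pi).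
Proof.
move=> t; rewrite mulrDr -[RHS](periodicn (@cosD2pi R) k); congr cos.
by rewrite -mulr_natr -[pi *+ 2]mulr_natr; ring.
Qed.

Lemma periodic_sinn k : periodic (fun t : R => sin (k%:R * t)) (2 * pi).
Proof.
move=> t; rewrite mulrDr -[RHS](periodicn (@sinD2pi R) k); congr sin.
by rewrite -mulr_natr -[pi *+ 2]mulr_natr; ring.
Qed.

Lemma is_derive_sinM (k x : R) :
  is_derive x (1 : R) (fun t => sin (k * t)) (k * cos (k * x)).
Proof.
have dl : is_derive x (1 : R) (fun t => k * t) k.
  by have := is_deriveZ k (is_derive_id x (1 : R)); rewrite /GRing.scale /= mulr1.
by have := is_derive1_comp (is_derive_sin (k * x)) dl; rewrite mulrC.
Qed.

Lemma is_derive_cosM (k x : R) :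
  is_derive x (1 : R) (fun t => cos (k * t)) (- (k * sin (k * x))).
Proof.
have dl : is_derive x (1 : R) (fun t => k * t) k.
  by have := is_deriveZ k (is_derive_id x (1 : R)); rewrite /GRing.scale /= mulr1.
by have := is_derive1_comp (is_derive_cos (k * x)) dl; rewrite mulNr mulrC.
Qed.

(** [k * cos (k * t)] is the derivative of the periodic function [sin (k * t)], so it integrates to
    0; then divide by [k]. *)
Lemma circint_cosn k : (0 < k)%N -> circint (fun t : R => cos (k%:R * t)) = 0.
Proof.
move=> k0; have kn0 : (k%:R : R) != 0 by rewrite pnatr_eq0 -lt0n.
have E : circint (fun t : R => k%:R * cos (k%:R * t)) = 0.
  rewrite -(subrr (sin (k%:R * (0 : R)))) -{1}(periodic_sinn k 0) add0r.
  apply: (@circint_derive R (fun t => sin (k%:R * t))); first by auto with cont.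
  by move=> x; exact: is_derive_sinM.
apply: (mulfI kn0); rewrite mulr0 -E circintZ//.
exact/continuous_cintegrable/continuous_cosM.
Qed.

Lemma circint_sinn k : circint (fun t : R => sin (k%:R * t)) = 0.
Proof.
have [->|k0] := posnP k.
  rewrite -[RHS](@mul0r R (2 * pi)) -circint_cst; congr circint.
  by apply/funext => t; rewrite mul0r sin0.
have kn0 : (k%:R : R) != 0 by rewrite pnatr_eq0 -lt0n.
have E : circint (fun t : R => k%:R * sin (k%:R * t)) = 0.
  rewrite -(subrr (- cos (k%:R * (0 : R)))) -{1}(periodic_cosn k 0) add0r.
  apply: (@circint_derive R (fun t => - cos (k%:R * t))); first by auto with cont.
  move=> x; rewrite -[X in is_derive _ _ _ X]opprK.
  by apply: is_deriveN; exact: is_derive_cosM.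
apply: (mulfI kn0); rewrite mulr0 -E circintZ//.
exact/continuous_cintegrable/continuous_sinM.
Qed.

Lemma circint_cosBn k l : circint (fun t : R => cos (k%:R * t - l%:R * t)) =
  if k == l then 2 * pi else 0.
Proof.
wlog lk : k l / (l <= k)%N => [H|].
  have [/H//|/ltnW/H E] := leqP l k; rewrite eq_sym -E; congr circint.
  by apply/funext => t; rewrite -cosN opprB.
rewrite (_ : (fun _ => _) = fun t : R => cos ((k - l)%:R * t)); last first.
  by apply/funext => t; rewrite natrB// mulrBl.
case: eqVneq => [->|kl].
  rewrite subnn -[RHS]mul1r -circint_cst; congr circint.
  by apply/funext => t; rewrite mul0r cos0.
by rewrite circint_cosn// subn_gt0 ltn_neqAle eq_sym kl.
Qed.

Lemma circint_cosDn k l : (0 < k)%N ->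
  circint (fun t : R => cos (k%:R * t + l%:R * t)) = 0.
Proof.
move=> k0; rewrite -[RHS](@circint_cosn (k + l)) ?addn_gt0 ?k0//.
by congr circint; apply/funext => t; rewrite natrD mulrDl.
Qed.

Lemma circint_cos_cos k l : (0 < k)%N ->
  circint (fun t : R => cos (k%:R * t) * cos (l%:R * t)) = if k == l then pi else 0.
Proof.
move=> k0.
rewrite (_ : (fun _ => _) = fun t : R => 2^-1 *
  (cos (k%:R * t - l%:R * t) + cos (k%:R * t + l%:R * t))); last first.
  by apply/funext => t; rewrite cosB cosD; field.
have cc (m : R) : cintegrable (fun t : R => cos (m * t)).
  exact/continuous_cintegrable/continuous_cosM.
have c1 : cintegrable (fun t : R => cos (k%:R * t - l%:R * t)).
  by under [X in cintegrable X]eq_fun do rewrite -mulrBl.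
have c2 : cintegrable (fun t : R => cos (k%:R * t + l%:R * t)).
  by under [X in cintegrable X]eq_fun do rewrite -mulrDl.
rewrite circintZ ?circintD//; last exact: cintegrableD.
by rewrite circint_cosBn circint_cosDn//; case: ifP => _; field.
Qed.

Lemma circint_sin_sin k l : (0 < k)%N ->
  circint (fun t : R => sin (k%:R * t) * sin (l%:R * t)) = if k == l then pi else 0.
Proof.
move=> k0.
rewrite (_ : (fun _ => _) = fun t : R =>
  cos (k%:R * t - l%:R * t) - cos (k%:R * t) * cos (l%:R * t)); last first.
  by apply/funext => t; rewrite cosB; ring.
rewrite circintB ?circint_cosBn ?circint_cos_cos//.
- by case: ifP => _; ring.
- under [X in cintegrable X]eq_fun do rewrite -mulrBl.
  exact/continuous_cintegrable/continuous_cosM.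
- by apply: continuous_cintegrable; auto with cont.
Qed.

Lemma circint_sinBn k l : circint (fun t : R => sin (k%:R * t - l%:R * t)) = 0.
Proof.
have [lk|/ltnW kl] := leqP l k.
  rewrite -[RHS](@circint_sinn (k - l)); congr circint.
  by apply/funext => t; rewrite natrB// mulrBl.
rewrite -[RHS]oppr0 -[in RHS](@circint_sinn (l - k)) -[RHS]mulN1r -circintZ.
  by congr circint; apply/funext => t; rewrite natrB// mulrBl -[in RHS]opprB sinN; ring.
exact/continuous_cintegrable/continuous_sinM.
Qed.

Lemma circint_cos_sin k l :
  circint (fun t : R => cos (k%:R * t) * sin (l%:R * t)) = 0.
Proof.
rewrite (_ : (fun _ => _) = fun t : R => 2^-1 *
  (sin ((k + l)%:R * t) + sin (l%:R * t - k%:R * t))); last first.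
  by apply/funext => t; rewrite natrD mulrDl sinB sinD; field.
have c1 : cintegrable (fun t : R => sin (l%:R * t - k%:R * t)).
  under [X in cintegrable X]eq_fun do rewrite -mulrBl.
  exact/continuous_cintegrable/continuous_sinM.
have c2 : cintegrable (fun t : R => sin ((k + l)%:R * t)).
  exact/continuous_cintegrable/continuous_sinM.
rewrite circintZ ?circintD//; last exact: cintegrableD.
by rewrite circint_sinn circint_sinBn addr0 mulr0.
Qed.

End trigonometric_system.

(** * Fejer's theorem, Parseval and Bessel *)

Section fejer.
Context {R : realType}.
Implicit Types (f : R -> R) (k m n : nat) (t u : R).

(** Not normalized: the usual factor [pi^-1] appears in [fourier_sum] instead. *)
Definition coefc f k : R := circint (fun t => f t * cos (k%:R * t)).
Definition coefs f k : R := circint (fun t => f t * sin (k%:R * t)).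

Definition fourier_sum m f t : R := (2 * pi)^-1 * circint f +
  pi^-1 * \sum_(k < m) (coefc f k.+1 * cos (k.+1%:R * t) + coefs f k.+1 * sin (k.+1%:R * t)).

Definition fejer_sum n f t : R := n%:R^-1 * \sum_(m < n) fourier_sum m f t.

Definition dirichlet m u : R := 1 + \sum_(k < m) 2 * cos (k.+1%:R * u).

(* [n] times the usual Fejer kernel. *)
Definition fejer n u : R := \sum_(m < n) dirichlet m u.

(** The factor [1 - cos u] makes the kernel telescope over [m], so that [fejer_cos] follows by
    telescoping once more. Closed forms in this shape also cover the points where a quotient would
    be undefined. *)
Lemma dirichlet_cos m u :
  dirichlet m u * (1 - cos u) = cos (m%:R * u) - cos (m.+1%:R * u).
Proof.
elim: m => [|m IH].
  by rewrite /dirichlet big_ord0 addr0 mul0r mul1r cos0 mul1r.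
have -> : dirichlet m.+1 u = dirichlet m u + 2 * cos (m.+1%:R * u).
  by rewrite /dirichlet big_ord_recr /= addrA.
have E1 : cos (m%:R * u) = cos (m.+1%:R * u) * cos u + sin (m.+1%:R * u) * sin u.
  by rewrite -cosB; congr cos; rewrite -natr1; ring.
have E2 : cos (m.+2%:R * u) = cos (m.+1%:R * u) * cos u - sin (m.+1%:R * u) * sin u.
  by rewrite -cosD; congr cos; rewrite -natr1; ring.
by rewrite mulrDl IH E1 E2; ring.
Qed.

Lemma fejer_cos n u : fejer n u * (1 - cos u) = 1 - cos (n%:R * u).
Proof.
elim: n => [|n IH]; first by rewrite /fejer big_ord0 !mul0r cos0 subrr.
have -> : fejer n.+1 u = fejer n u + dirichlet n u by rewrite /fejer big_ord_recr.
by rewrite mulrDl IH dirichlet_cos; ring.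
Qed.

(** Where [cos u] differs from 1, divide [fejer_cos] by [1 - cos u]; elsewhere every [cos (k * u)]
    is 1 and all summands are nonnegative. *)
Lemma fejer_ge0 n u : 0 <= fejer n u.
Proof.
have [c1|c1] := eqVneq (cos u) 1; last first.
  have c0 : 0 < 1 - cos u by rewrite subr_gt0 lt_neqAle c1 cos_le1.
  by rewrite -(pmulr_lge0 _ c0) fejer_cos subr_ge0 cos_le1.
have s0 : sin u = 0 by apply/eqP; rewrite -sqrf_eq0 sin2cos2 c1 expr1n subrr.
have ck k : cos (k%:R * u) = 1.
  elim: k => [|k IH]; first by rewrite mul0r cos0.
  by rewrite -natr1 mulrDl mul1r cosD IH c1 s0 mulr0 mulr1 subr0.
apply: sumr_ge0 => m _; apply: addr_ge0 => //; apply: sumr_ge0 => k _.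
by rewrite ck mulr1.
Qed.

Lemma continuous_dirichlet m : continuous (dirichlet m).
Proof. by apply: continuous_funD; auto with cont. Qed.

Lemma continuous_fejer n : continuous (fejer n).
Proof. by apply: continuous_fun_sum => m; exact: continuous_dirichlet. Qed.

Lemma continuous_reflect (h : R -> R) t : continuous h -> continuous (fun x => h (t - x)).
Proof.
move=> ch; have := @continuous_affine_comp _ _ (-1) t ch.
by under [X in continuous X]eq_fun do rewrite mulN1r addrC.
Qed.

Lemma fourier_sum_kernel f m t : continuous f ->
  fourier_sum m f t = (2 * pi)^-1 * circint (fun x => f x * dirichlet m (t - x)).
Proof.
move=> cf.
pose F (k : 'I_m) x := 2 * (cos (k.+1%:R * t) * (f x * cos (k.+1%:R * x)) +
  sin (k.+1%:R * t) * (f x * sin (k.+1%:R * x))).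
have cfc k : cintegrable (fun x => f x * cos (k%:R * x)).
  by apply: continuous_cintegrable; auto with cont.
have cfs k : cintegrable (fun x => f x * sin (k%:R * x)).
  by apply: continuous_cintegrable; auto with cont.
have cF (k : 'I_m) : cintegrable (F k).
  by apply: cintegrableZ; apply: cintegrableD; apply: cintegrableZ.
have -> : (fun x => f x * dirichlet m (t - x)) = fun x => f x + \sum_(k < m) F k x.
  apply/funext => x; rewrite /dirichlet mulrDr mulr1 mulr_sumr; congr (_ + _).
  by apply: eq_bigr => k _; rewrite /F mulrBr cosB; ring.
rewrite circintD//; [|exact: continuous_cintegrable|exact: cintegrable_sum].
rewrite circint_sum// mulrDr; congr (_ + _); rewrite !mulr_sumr.
apply: eq_bigr => k _.
rewrite circintZ ?circintD ?circintZ//; [|exact: cintegrableZ|exact: cintegrableZ|].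
  by rewrite /coefc /coefs; have := @pi_gt0 R => ?; field; lra.
by apply: cintegrableD; exact: cintegrableZ.
Qed.

Lemma fejer_sum_kernel f n t : continuous f ->
  fejer_sum n f t = (2 * pi * n%:R)^-1 * circint (fun x => f x * fejer n (t - x)).
Proof.
move=> cf; rewrite /fejer_sum.
have -> : (fun x => f x * fejer n (t - x)) =
    fun x => \sum_(m < n) f x * dirichlet m (t - x).
  by apply/funext => x; rewrite mulr_sumr.
rewrite circint_sum; last first.
  move=> m; apply/continuous_cintegrable/continuous_funM => //.
  exact/continuous_reflect/continuous_dirichlet.
rewrite invfM -mulrA mulrCA; congr (_ * _); rewrite mulr_sumr.
by apply: eq_bigr => m _; exact: fourier_sum_kernel.
Qed.

(** The kernel formula for the constant function 1, all of whose Fourier sums are 1. *)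
Lemma circint_fejer n t : circint (fun x => fejer n (t - x)) = 2 * pi * n%:R.
Proof.
have pi0 := @pi_gt0 R.
have := @fejer_sum_kernel (fun=> 1) n t (@continuous_fun_cst R 1).
under [in X in _ = X -> _]eq_fun do rewrite mul1r.
have -> : fejer_sum n (fun=> 1) t = n%:R^-1 * n%:R.
  rewrite /fejer_sum; congr (_ * _).
  rewrite (eq_bigr (fun=> 1)) ?sumr_const ?card_ord// => m _.
  rewrite /fourier_sum circint_cst big1 => [|k _]; first by field; lra.
  rewrite /coefc /coefs.
  under [in X in X * _ + _]eq_fun do rewrite mul1r.
  under [in X in _ + X * _]eq_fun do rewrite mul1r.
  by rewrite circint_cosn// circint_sinn !mul0r addr0.
have [->|n0] := posnP n.
  move=> _; rewrite mulr0 -[RHS](mul0r (2 * pi)) -circint_cst; congr circint.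
  by apply/funext => x; rewrite /fejer big_ord0.
have nR : (n%:R : R) != 0 by rewrite pnatr_eq0 -lt0n.
have P0 : 2 * pi * n%:R != 0 :> R by rewrite gt_eqF // mulr_gt0 ?twopi_gt0 ?ltr0n.
by rewrite mulVf// => E; apply: (mulfI (invr_neq0 P0)); rewrite -E mulVf.
Qed.

(** The hypothesis is tailored to the kernel. By [fejer_cos], kernel times [1 - cos (t - x)] is
    [1 - cos (n * (t - x))], with integral [2 * pi]; dividing by the mass [2 * pi * n] of the kernel
    leaves [C / n], without splitting the domain into near and far points. *)
Lemma fejer_approx f (e C : R) n t : continuous f -> (0 < n)%N -> 0 <= C ->
  (forall x, `|f t - f x| <= e + C * (1 - cos (t - x))) ->
  `|f t - fejer_sum n f t| <= e + C / n%:R.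
Proof.
move=> cf n0 C0 H; have pi0 := @pi_gt0 R.
have nR : 0 < (n%:R : R) by rewrite ltr0n.
have P0 : 0 < 2 * pi * n%:R :> R by rewrite !mulr_gt0.
have cK : continuous (fun x => fejer n (t - x)).
  exact/continuous_reflect/continuous_fejer.
have cn : cintegrable (fun x => cos (n%:R * (t - x))).
  apply: continuous_cintegrable; apply: (@continuous_reflect (fun y => cos (n%:R * y))).
  by auto with cont.
have iKf : cintegrable (fun x => f x * fejer n (t - x)).
  by apply: continuous_cintegrable; auto with cont.
have iKt : cintegrable (fun x => f t * fejer n (t - x)).
  by apply: continuous_cintegrable; auto with cont.
have -> : f t - fejer_sum n f t = (2 * pi * n%:R)^-1 *
    circint (fun x => f t * fejer n (t - x) - f x * fejer n (t - x)).
  rewrite circintB// mulrBr -(@fejer_sum_kernel f n t)// circintZ; last first.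
    exact: continuous_cintegrable.
  by rewrite circint_fejer; congr (_ - _); field; lra.
rewrite normrM ger0_norm ?invr_ge0 ?(ltW P0)// -ler_pdivlMl ?invr_gt0// invrK.
apply: le_trans (le_normr_circint (cintegrableB iKt iKf)) _.
have -> : 2 * pi * n%:R * (e + C / n%:R) =
    circint (fun x => e * fejer n (t - x) + C * (1 - cos (n%:R * (t - x)))).
  have ic1 : cintegrable (fun=> 1 : R).
    exact/continuous_cintegrable/continuous_fun_cst.
  rewrite circintD ?circintZ ?circint_fejer ?circintB ?circint_cst//.
  - have -> : circint (fun x => cos (n%:R * (t - x))) = 0.
      rewrite (_ : (fun _ => _) = fun x => cos (n%:R * t) * cos (n%:R * x) +
        sin (n%:R * t) * sin (n%:R * x)); last first.
        by apply/funext => x; rewrite mulrBr cosB.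
      rewrite circintD ?circintZ ?circint_cosn ?circint_sinn ?mulr0 ?addr0//.
      + exact/continuous_cintegrable/continuous_sinM.
      + exact/continuous_cintegrable/continuous_cosM.
      + by apply: continuous_cintegrable; auto with cont.
      + by apply: continuous_cintegrable; auto with cont.
    by field; lra.
  - exact: cintegrableB.
  - exact: continuous_cintegrable.
  - by apply: cintegrableZ; exact: continuous_cintegrable.
  - by apply: cintegrableZ; exact: cintegrableB.
apply: le_circint.
- have cd : continuous (fun x : R => f t * fejer n (t - x) - f x * fejer n (t - x) : R).
    apply: continuous_funB (continuous_funM cf cK).
    exact: (continuous_funM (@continuous_fun_cst R (f t)) cK).
  by apply: continuous_cintegrable => x; exact: cvg_norm (cd x).
- apply: cintegrableD; apply: cintegrableZ; first exact: continuous_cintegrable.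
  by apply: cintegrableB => //; exact/continuous_cintegrable/continuous_fun_cst.
move=> x; rewrite -mulrBl normrM (ger0_norm (fejer_ge0 _ _)).
apply: le_trans (ler_wpM2r (fejer_ge0 _ _) (H x)) _.
by rewrite mulrDl -mulrA [(1 - _) * _]mulrC fejer_cos.
Qed.

End fejer.

(** * Bounding increments of a periodic function by [1 - cos] *)

Section kernel_bound.
Context {R : realType}.
Implicit Types f : R -> R.

Definition unif f : Prop := forall e : R, 0 < e -> exists2 d : R, 0 < d &
  forall x y : R, `|y - x| < d -> `|f y - f x| < e.

Lemma unif_continuous_fun f : unif f -> continuous f.
Proof.
move=> uf x; apply/cvgrPdist_lt => e e0; have [d d0 H] := uf _ e0.
near=> y; apply: H; near: y.
by apply/nbhs_ballP; exists d => //= y; rewrite /ball /= distrC.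
Unshelve. all: by end_near. Qed.

Lemma unif_shiftB f (s : R) : unif f -> unif (fun t => f (t + s) - f t).
Proof.
move=> uf e e0; have e20 : 0 < e / 2 by rewrite divr_gt0.
have [d d0 H] := uf _ e20; exists d => // x y xy.
rewrite [X in `|X|](_ : _ = (f (y + s) - f (x + s)) - (f y - f x)); last by ring.
apply: le_lt_trans (ler_normB _ _) _.
have h1 := H _ _ xy; have h2 := H (x + s) (y + s).
by rewrite [e]splitr ltrD// h2// opprD addrACA subrr addr0.
Qed.

(** Two close points, moved so that the left one lies in [[0, 2 * pi[], either both lie in the
    period or straddle its end; in the latter case the common value at [0] and [2 * pi] mediates, at
    a cost of [e / 2] on each side. *)
Lemma unif_circle f : periodic f (2 * pi) -> ac_on 0 (2 * pi) f -> unif f.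
Proof.
move=> pf acf e e0; have e20 : 0 < e / 2 by rewrite divr_gt0.
have tp0 := @twopi_gt0 R.
have [d d0 H] := ac_on_uniform_continuous acf e20.
have hz : f (2 * pi) = f 0 by rewrite -(pf 0) add0r.
suff S x y : x <= y -> y - x < Num.min d (2 * pi) -> `|f y - f x| < e.
  exists (Num.min d (2 * pi)) => [|x y]; first by rewrite lt_min d0.
  have [xy|/ltW yx] := leP x y; first by rewrite ger0_norm ?subr_ge0//; exact: S.
  by rewrite distrC ger0_norm ?subr_ge0// distrC; exact: S.
move=> xy; rewrite lt_min => /andP[xyd xyp].
have [k /andP[]] := reduce_modulo x tp0.
rewrite -[f y](periodic_int (- k) y pf) -[f x](periodic_int (- k) x pf) mulrNz mulNr.
move: xy xyd xyp; set z := k%:~R * _ => xy xyd xyp x0 x2.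
have [y2|y2] := leP (y - z) (2 * pi).
  apply: (@lt_trans _ _ (e / 2)); last lra.
  apply: H; [by apply/andP; split; lra|by apply/andP; split; lra|].
  by rewrite ger0_norm; lra.
rewrite -[f (y - z)](subrK (f (2 * pi))) {2}hz -addrA.
apply: le_lt_trans (ler_normD _ _) _.
have -> : f (y - z) = f (y - z - 2 * pi).
  by rewrite -(pf (y - z - 2 * pi)) subrK.
rewrite [e]splitr; apply: ltrD.
  rewrite hz; apply: H; [by apply/andP; split; lra|by apply/andP; split; lra|].
  by rewrite ger0_norm; lra.
rewrite -hz; apply: H; [by apply/andP; split; lra|by apply/andP; split; lra|].
by rewrite ger0_norm; lra.
Qed.

Lemma cos_periodic_int (k : int) (t : R) : cos (t + k%:~R * (2 * pi)) = cos t.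
Proof.
by apply: periodic_int => u; rewrite mulr_natl; exact: cosD2pi.
Qed.

(** At points closer than [d] on the circle uniform continuity gives [e]; at all others [1 - cos] is
    at least [1 - cos d], so a multiple of it exceeds the oscillation [M]. *)
Lemma unif_kernel_bound f (e : R) : periodic f (2 * pi) -> unif f -> 0 < e ->
  exists2 C : R, 0 <= C & forall t x, `|f t - f x| <= e + C * (1 - cos (t - x)).
Proof.
move=> pf uf e0; have cf := unif_continuous_fun uf; have tp0 := @twopi_gt0 R.
have [M M0 HM] : exists2 M : R, 0 <= M & forall t x, `|f t - f x| <= M.
  have [u _ Hu] := EVT_max (ltW tp0) (continuous_subspaceT cf).
  have [v _ Hv] := EVT_min (ltW tp0) (continuous_subspaceT cf).
  have fu t : f t <= f u.
    have [k /andP[t0 t2]] := reduce_modulo t tp0.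
    rewrite -(periodic_int (- k) t pf) mulrNz mulNr; apply: Hu.
    by rewrite in_itv /= t0 ltW.
  have fv t : f v <= f t.
    have [k /andP[t0 t2]] := reduce_modulo t tp0.
    rewrite -(periodic_int (- k) t pf) mulrNz mulNr; apply: Hv.
    by rewrite in_itv /= t0 ltW.
  exists (f u - f v); first by rewrite subr_ge0.
  move=> t x; rewrite ler_norml; have := fu t; have := fv t; have := fu x; have := fv x.
  by move=> *; apply/andP; split; lra.
have [d0 d00 H0] := uf _ e0; have pi0 := @pi_gt0 R.
(* Up to [pi] the cosine is decreasing, which gives [cos d < 1] and the comparison of [cos w] with
   [cos d]. *)
pose d := Num.min d0 pi.
have d_gt0 : 0 < d by rewrite lt_min d00.
have dpi : d <= pi by rewrite ge_min lexx orbT.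
have cd : cos d < 1.
  by rewrite -[ltRHS]cos0 ltr_cos// in_itv /= ?lexx ?(ltW pi0)// (ltW d_gt0).
exists (M / (1 - cos d)) => [|t x]; first by rewrite divr_ge0 ?subr_ge0// ltW.
have C0 : 0 <= M / (1 - cos d) by rewrite divr_ge0 ?subr_ge0// ltW.
(* The added [pi] centres the residue: [w] below is [t - x] modulo the period, taken in
   [[-pi, pi]]. *)
have [k /andP[k1 k2]] := reduce_modulo (t - x + pi) tp0.
set z := k%:~R * (2 * pi) in k1 k2.
have -> : f t = f (t - z) by rewrite -(periodic_int (- k) t pf) mulrNz mulNr.
have -> : cos (t - x) = cos (t - z - x).
  by rewrite -(cos_periodic_int (- k)) mulrNz mulNr -/z; congr cos; ring.
set w := t - z - x.
have wpi : `|w| <= pi by rewrite ler_norml /w; apply/andP; split; lra.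
have [wd|dw] := ltP `|w| d.
  apply: (@le_trans _ _ e); last by rewrite lerDl mulr_ge0// subr_ge0 cos_le1.
  by apply/ltW/H0/(lt_le_trans wd); rewrite ge_min lexx.
apply: (le_trans (HM _ _)); have cw : cos w <= cos d.
  have -> : cos w = cos `|w| by case: ler0P; rewrite ?cosN.
  move: dw; rewrite le_eqVlt => /predU1P[<-//|dw]; apply/ltW.
  by rewrite ltr_cos// in_itv /= ?normr_ge0 ?wpi ?dpi ?(ltW d_gt0).
rewrite -[leLHS]add0r lerD// ?(ltW e0)//.
rewrite -mulrA -[leLHS]mulr1 ler_wpM2l//.
by rewrite mulrC ler_pdivlMr ?subr_gt0// mul1r lerD2l lerN2.
Qed.

End kernel_bound.

(** * Bessel's inequality and the upper half of Parseval's identity *)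

Section parseval_bessel.
Context {R : realType}.
Notation mu := (@lebesgue_measure R).
Implicit Types f g : R -> R.

Definition trig_poly (a b : nat -> R) n t : R :=
  \sum_(k < n) (a k.+1 * cos (k.+1%:R * t) + b k.+1 * sin (k.+1%:R * t)).

(** This is [pi] times the integral of the square of the [n]-th Fourier sum without its constant
    term, which is treated separately. *)
Definition energy f n : R := \sum_(k < n) (coefc f k.+1 ^+ 2 + coefs f k.+1 ^+ 2).

Lemma continuous_trig_poly a b n : continuous (trig_poly a b n).
Proof.
by apply: continuous_fun_sum => k; apply: continuous_funD; auto with cont.
Qed.

Lemma fourier_sumE f m t : fourier_sum m f t =
  (2 * pi)^-1 * circint f + pi^-1 * trig_poly (coefc f) (coefs f) m t.
Proof. by []. Qed.

Lemma cintegrable_bounded_mul g h : cintegrable g -> continuous h ->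
  (forall t, `|h t| <= 1) -> cintegrable (fun t => g t * h t).
Proof.
move=> ig ch h1.
have mh : measurable_fun (one_period R) h.
  by apply: measurable_funTS; exact: continuous_measurable_fun.
have mg : measurable_fun (one_period R) g by apply/measurable_EFinP; exact: measurable_int ig.
apply: (@le_integrable _ _ R mu (one_period R) _ (EFin \o (fun t => g t * h t)) (EFin \o g)).
- exact: measurable_one_period.
- by apply/measurable_EFinP; exact: measurable_funM.
- move=> t _; rewrite /= lee_fin normrM -[leRHS]mulr1.
  exact: ler_wpM2l.
- exact: ig.
Qed.

Lemma cintegrable_coefc g k : cintegrable g -> cintegrable (fun t => g t * cos (k%:R * t)).
Proof.
move=> ig; apply: cintegrable_bounded_mul => //; first exact: continuous_cosM.
by move=> t; exact: cos_max.
Qed.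

Lemma cintegrable_coefs g k : cintegrable g -> cintegrable (fun t => g t * sin (k%:R * t)).
Proof.
move=> ig; apply: cintegrable_bounded_mul => //; first exact: continuous_sinM.
by move=> t; exact: sin_max.
Qed.

Lemma cintegrable_mul_trig_poly g a b n : cintegrable g ->
  cintegrable (fun t => g t * trig_poly a b n t).
Proof.
move=> ig.
rewrite (_ : (fun _ => _) = fun t => \sum_(k < n) (a k.+1 * (g t * cos (k.+1%:R * t)) +
    b k.+1 * (g t * sin (k.+1%:R * t)))); last first.
  by apply/funext => t; rewrite mulr_sumr; apply: eq_bigr => k _; ring.
apply: cintegrable_sum => k; apply: cintegrableD; apply: cintegrableZ.
  exact: cintegrable_coefc.
exact: cintegrable_coefs.
Qed.

Lemma circint_mul_trig_poly g a b n : cintegrable g ->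
  circint (fun t => g t * trig_poly a b n t) =
  \sum_(k < n) (a k.+1 * coefc g k.+1 + b k.+1 * coefs g k.+1).
Proof.
move=> ig; have ic k := @cintegrable_coefc g k ig; have is_ k := @cintegrable_coefs g k ig.
rewrite (_ : (fun _ => _) = fun t => \sum_(k < n) (a k.+1 * (g t * cos (k.+1%:R * t)) +
    b k.+1 * (g t * sin (k.+1%:R * t)))); last first.
  by apply/funext => t; rewrite mulr_sumr; apply: eq_bigr => k _; ring.
rewrite circint_sum; last by move=> k; apply: cintegrableD; exact: cintegrableZ.
apply: eq_bigr => k _; rewrite circintD ?circintZ//; exact: cintegrableZ.
Qed.

Lemma coefc_trig_poly a b n j : (0 < j <= n)%N -> coefc (trig_poly a b n) j = pi * a j.
Proof.
case: j => // j /= jn; rewrite /coefc.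
under [in LHS]eq_fun do rewrite mulrC.
rewrite circint_mul_trig_poly; last exact/continuous_cintegrable/continuous_cosM.
rewrite (bigD1 (Ordinal jn)) //= big1 ?addr0 => [|k kj].
  rewrite /coefc /coefs circint_cos_cos// eqxx circint_cos_sin mulr0 addr0.
  by rewrite mulrC.
rewrite /coefc /coefs circint_cos_cos// circint_cos_sin mulr0 addr0 eqSS.
by rewrite ifN ?mulr0// eq_sym; apply: contra kj => /eqP E; apply/eqP/val_inj.
Qed.

Lemma coefs_trig_poly a b n j : (0 < j <= n)%N -> coefs (trig_poly a b n) j = pi * b j.
Proof.
case: j => // j /= jn; rewrite /coefs.
under [in LHS]eq_fun do rewrite mulrC.
rewrite circint_mul_trig_poly; last exact/continuous_cintegrable/continuous_sinM.
have sc k l : circint (fun t : R => sin (k%:R * t) * cos (l%:R * t)) = 0.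
  by under [in LHS]eq_fun do rewrite mulrC; exact: circint_cos_sin.
rewrite (bigD1 (Ordinal jn)) //= big1 ?addr0 => [|k kj].
  by rewrite /coefc /coefs circint_sin_sin// eqxx sc mulr0 add0r mulrC.
rewrite /coefc /coefs circint_sin_sin// sc mulr0 add0r eqSS.
by rewrite ifN ?mulr0// eq_sym; apply: contra kj => /eqP E; apply/eqP/val_inj.
Qed.

Lemma circint_mul_coef_trig_poly g n : cintegrable g ->
  circint (fun t => g t * trig_poly (coefc g) (coefs g) n t) = energy g n.
Proof.
by move=> ig; rewrite circint_mul_trig_poly.
Qed.

Lemma circint_trig_poly_sqr a b n :
  circint (fun t => trig_poly a b n t ^+ 2) =
  pi * \sum_(k < n) (a k.+1 ^+ 2 + b k.+1 ^+ 2).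
Proof.
under [in LHS]eq_fun do rewrite expr2.
rewrite circint_mul_trig_poly; last exact/continuous_cintegrable/continuous_trig_poly.
rewrite mulr_sumr; apply: eq_bigr => k _.
by rewrite coefc_trig_poly ?coefs_trig_poly//=; ring.
Qed.

(** [pi * g - T] is [pi] times the distance of [g] from its projection; the integral of its square
    is [pi ^ 2] times that of [g ^ 2], minus [2 * pi * energy], plus [pi * energy]. *)
Lemma bessel g n : cintegrable g -> cintegrable (fun t => g t ^+ 2) ->
  energy g n <= pi * circint (fun t => g t ^+ 2).
Proof.
move=> ig ig2; have pi0 := @pi_gt0 R.
set T := trig_poly (coefc g) (coefs g) n.
have iT : cintegrable (fun t => T t ^+ 2).
  by apply/continuous_cintegrable/continuous_funX/continuous_trig_poly.
have igT := cintegrable_mul_trig_poly (coefc g) (coefs g) n ig.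
have : 0 <= circint (fun t => (pi * g t - T t) ^+ 2).
  by apply: circint_ge0 => t; exact: sqr_ge0.
rewrite (_ : (fun _ => _) = fun t => pi ^+ 2 * g t ^+ 2 - 2 * pi * (g t * T t) + T t ^+ 2);
  last by apply/funext => t; ring.
have i1 := cintegrableZ (pi ^+ 2) ig2; have i2 := cintegrableZ (2 * pi) igT.
rewrite circintD ?circintB ?circintZ//; last exact: cintegrableB.
rewrite circint_mul_coef_trig_poly// circint_trig_poly_sqr -/(energy g n) => h.
by rewrite -(ler_pM2l pi0); lra.
Qed.

Lemma le_energy f m n : (m <= n)%N -> energy f m <= energy f n.
Proof.
elim: n => [|n IH]; first by rewrite leqn0 => /eqP ->.
rewrite leq_eqVlt => /predU1P[->//|]; rewrite ltnS => /IH /le_trans; apply.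
by rewrite /energy big_ord_recr /= lerDl addr_ge0// sqr_ge0.
Qed.

(* Only this half of Parseval's identity needs completeness of the trigonometric system. *)
Lemma parseval_le f (e : R) : periodic f (2 * pi) -> unif f -> 0 < e ->
  exists N : nat, forall n, (N <= n)%N ->
  circint (fun t => f t ^+ 2) <=
    (2 * pi)^-1 * circint f ^+ 2 + pi^-1 * energy f n + e.
Proof.
move=> pf uf e0; have cf := unif_continuous_fun uf; have pi0 := @pi_gt0 R.
have if_ := continuous_cintegrable cf.
have cnf : continuous (fun t => `|f t|) by move=> t; exact: cvg_norm (cf t).
have inf := continuous_cintegrable cnf.
pose B := circint (fun t => `|f t|); have B0 : 0 <= B by apply: circint_ge0.
(* The uniform error will be [2 * d], which costs [2 * d * B <= e] after multiplication by [f] and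
   integration; [B + 1] is positive even if [B = 0]. *)
pose d := e / (2 * (B + 1)).
have d0 : 0 < d by rewrite divr_gt0// mulr_gt0// ltr_pwDr.
have [C C0 HC] := unif_kernel_bound pf uf d0.
pose N := (Num.bound (C / d)).+1.
have N0 : 0 < (N%:R : R) by rewrite ltr0n.
have CN : C / N%:R <= d.
  rewrite ler_pdivrMr// mulrC -ler_pdivrMr//.
  apply: (@le_trans _ _ (Num.bound (C / d))%:R); last by rewrite ler_nat.
  by apply/ltW/archi_boundP; rewrite divr_ge0// ltW.
exists N => n Nn.
have app t : `|f t - fejer_sum N f t| <= 2 * d.
  have := @fejer_approx R f d C N t cf isT C0 (HC t); lra.
have cS m : continuous (fourier_sum m f).
  apply: continuous_funD; first exact: continuous_fun_cst.
  by apply: continuous_funM; [exact: continuous_fun_cst|exact: continuous_trig_poly].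
have cF : continuous (fejer_sum N f).
  by apply: continuous_funM; [exact: continuous_fun_cst|exact: continuous_fun_sum].
have ifF : cintegrable (fun t => f t * fejer_sum N f t).
  exact/continuous_cintegrable/continuous_funM.
have le1 : circint (fun t => f t ^+ 2) <= circint (fun t => f t * fejer_sum N f t + 2 * d * `|f t|).
  apply: le_circint; first exact/continuous_cintegrable/continuous_funX.
    by apply: cintegrableD => //; exact: cintegrableZ.
  move=> t; rewrite -lerBlDl expr2 -mulrBr (le_trans (ler_norm _))// normrM mulrC.
  exact: ler_wpM2r.
apply: (le_trans le1); rewrite circintD ?circintZ//; last exact: cintegrableZ.
rewrite -/B; apply: lerD; last first.
  rewrite /d -subr_ge0 (_ : _ - _ = e / (B + 1)); last by field; lra.
  by rewrite divr_ge0 ?(ltW e0)// addr_ge0.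
rewrite (_ : (fun _ => _) = fun t => N%:R^-1 * \sum_(m < N) f t * fourier_sum m f t); last first.
  by apply/funext => t; rewrite /fejer_sum mulrCA mulr_sumr.
have ifS m : cintegrable (fun t => f t * fourier_sum m f t).
  exact/continuous_cintegrable/continuous_funM.
rewrite circintZ; last exact: cintegrable_sum.
rewrite circint_sum// ler_pdivrMl//.
(* Integrating [f] against its [m]-th Fourier sum gives exactly the mean term plus
   [pi^-1 * energy f m], and the energies increase with [m], while [m < N <= n]. *)
apply: (@le_trans _ _ (\sum_(m < N) ((2 * pi)^-1 * circint f ^+ 2 + pi^-1 * energy f n))).
  apply: ler_sum => m _.
  rewrite (_ : (fun _ => _) = fun t => (2 * pi)^-1 * circint f * f t +
    pi^-1 * (f t * trig_poly (coefc f) (coefs f) m t)); last first.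
    by apply/funext => t; rewrite fourier_sumE; ring.
  have iT := cintegrable_mul_trig_poly (coefc f) (coefs f) m if_.
  rewrite circintD ?circintZ//; [|exact: cintegrableZ|exact: cintegrableZ].
  rewrite circint_mul_coef_trig_poly// expr2 mulrA lerD2l ler_wpM2l ?invr_ge0 ?(ltW pi0)//.
  by apply: le_energy; rewrite (leq_trans _ Nn)// ltnW.
by rewrite sumr_const card_ord -[leLHS]mulr_natl.
Qed.

End parseval_bessel.

(** * Fourier coefficients of translates and derivatives *)

Section shifted_coefficients.
Context {R : realType}.
Implicit Types f : R -> R.

Lemma coefc_shift f k (s : R) : continuous f -> periodic f (2 * pi) ->
  coefc (fun t => f (t + s)) k =
  cos (k%:R * s) * coefc f k + sin (k%:R * s) * coefs f k.
Proof.
move=> cf pf; have if_ := continuous_cintegrable cf.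
(* This is [f t * cos (k * (t - s))], expanded. *)
pose h t := cos (k%:R * s) * (f t * cos (k%:R * t)) + sin (k%:R * s) * (f t * sin (k%:R * t)).
have ch : continuous h.
  apply: continuous_funD; apply: continuous_funM; auto with cont; exact: continuous_fun_cst.
have ph : periodic h (2 * pi).
  by move=> t; rewrite /h pf periodic_cosn periodic_sinn.
transitivity (circint (fun t => h (t + s))).
  congr circint; apply/funext => t; rewrite /h.
  rewrite [in LHS](_ : k%:R * t = k%:R * (t + s) - k%:R * s); last by ring.
  by rewrite cosB; ring.
rewrite circint_shift// circintD ?circintZ//; try apply: cintegrableZ;
  by [exact: cintegrable_coefc|exact: cintegrable_coefs].
Qed.

Lemma coefs_shift f k (s : R) : continuous f -> periodic f (2 * pi) ->
  coefs (fun t => f (t + s)) k =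
  cos (k%:R * s) * coefs f k - sin (k%:R * s) * coefc f k.
Proof.
move=> cf pf; have if_ := continuous_cintegrable cf.
(* This is [f t * sin (k * (t - s))], expanded. *)
pose h t := cos (k%:R * s) * (f t * sin (k%:R * t)) - sin (k%:R * s) * (f t * cos (k%:R * t)).
have ch : continuous h.
  apply: continuous_funB; apply: continuous_funM; auto with cont; exact: continuous_fun_cst.
have ph : periodic h (2 * pi).
  by move=> t; rewrite /h pf periodic_cosn periodic_sinn.
transitivity (circint (fun t => h (t + s))).
  congr circint; apply/funext => t; rewrite /h.
  rewrite [in LHS](_ : k%:R * t = k%:R * (t + s) - k%:R * s); last by ring.
  by rewrite sinB; ring.
rewrite circint_shift// circintB ?circintZ//; try apply: cintegrableZ;
  by [exact: cintegrable_coefc|exact: cintegrable_coefs].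
Qed.

(** Translation rotates the pair of coefficients by the angle [k * s], and a rotation by [x] moves a
    vector by [2 * (1 - cos x)] times its squared length, in square. *)
Lemma coef_sqr_shiftB f k (s : R) : continuous f -> periodic f (2 * pi) ->
  coefc (fun t => f (t + s) - f t) k ^+ 2 + coefs (fun t => f (t + s) - f t) k ^+ 2 =
  2 * (1 - cos (k%:R * s)) * (coefc f k ^+ 2 + coefs f k ^+ 2).
Proof.
move=> cf pf; have cfs := @continuous_funT _ f s cf.
have if_ := continuous_cintegrable cf; have ifs := continuous_cintegrable cfs.
have -> : coefc (fun t => f (t + s) - f t) k = coefc (fun t => f (t + s)) k - coefc f k.
  rewrite /coefc -circintB; [|exact: cintegrable_coefc|exact: cintegrable_coefc].
  by congr circint; apply/funext => t; rewrite mulrBl.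
have -> : coefs (fun t => f (t + s) - f t) k = coefs (fun t => f (t + s)) k - coefs f k.
  rewrite /coefs -circintB; [|exact: cintegrable_coefs|exact: cintegrable_coefs].
  by congr circint; apply/funext => t; rewrite mulrBl.
rewrite coefc_shift// coefs_shift//.
have := cos2Dsin2 (k%:R * s); move: (cos _) (sin _) (coefc f k) (coefs f k) => C S x y E.
transitivity ((C ^+ 2 + S ^+ 2 + 1 - 2 * C) * (x ^+ 2 + y ^+ 2)); first by ring.
by rewrite E; ring.
Qed.

Lemma norm_sin_mul_le k (x : R) : `|sin (k%:R * x)| <= k%:R * `|sin x|.
Proof.
elim: k => [|k IH]; first by rewrite mul0r sin0 normr0 mul0r.
rewrite -natr1 mulrDl mul1r sinD (le_trans (ler_normD _ _))// mulrDl mul1r.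
apply: lerD; rewrite normrM.
  apply: le_trans IH; rewrite -[leRHS]mulr1; apply: ler_wpM2l => //; exact: cos_max.
by rewrite -[leRHS]mul1r ler_wpM2r// cos_max.
Qed.

(** Strictness enters at [k = 2] through [|cos x| < 1], and the addition formula carries it to
    larger [k]. *)
Lemma norm_sin_mul_lt k (x : R) : (1 < k)%N -> sin x != 0 ->
  `|sin (k%:R * x)| < k%:R * `|sin x|.
Proof.
case: k => [|[|k]]// _ sx; have sx0 : 0 < `|sin x| by rewrite normr_gt0.
have cx : `|cos x| < 1.
  rewrite lt_neqAle cos_max andbT; apply: contra sx => /eqP c1.
  by rewrite -sqrf_eq0 sin2cos2 -[cos x ^+ 2](real_normK (num_real _)) c1 expr1n subrr.
have step n : `|sin (n%:R * x)| < n%:R * `|sin x| ->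
    `|sin (n.+1%:R * x)| < n.+1%:R * `|sin x|.
  move=> IH; rewrite -natr1 mulrDl mul1r sinD (le_lt_trans (ler_normD _ _))// mulrDl mul1r.
  apply: ltr_leD; rewrite normrM.
    apply: le_lt_trans IH; rewrite -[leRHS]mulr1; apply: ler_wpM2l => //; exact: cos_max.
  by rewrite -[leRHS]mul1r ler_wpM2r// cos_max.
elim: k => [|k IH]; last exact: step.
have -> : sin (2%:R * x) = 2 * (sin x * cos x).
  by rewrite mulr_natl mulr2n sinD; ring.
by rewrite !normrM normr_nat ltr_pM2l// gtr_pMr.
Qed.

Lemma onem_cosE (x : R) : 1 - cos x = 2 * sin (x / 2) ^+ 2.
Proof.
have -> : cos x = cos (x / 2 + x / 2) by congr cos; rewrite -splitr.
by rewrite cosD; have := cos2Dsin2 (x / 2) => h; nra.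
Qed.

Lemma onem_cos_mul_le k (s : R) : 1 - cos (k%:R * s) <= k%:R ^+ 2 * (1 - cos s).
Proof.
rewrite !onem_cosE [leRHS]mulrCA ler_pM2l// -exprMn -mulrA.
rewrite -[leLHS](real_normK (num_real _)) -[leRHS](real_normK (num_real _)) ler_sqr ?nnegrE//.
by rewrite [leRHS]normrM normr_nat norm_sin_mul_le.
Qed.

Lemma onem_cos_mul_lt k (s : R) : (1 < k)%N -> cos s != 1 ->
  1 - cos (k%:R * s) < k%:R ^+ 2 * (1 - cos s).
Proof.
move=> k1 cs; rewrite !onem_cosE [ltRHS]mulrCA ltr_pM2l// -exprMn -mulrA.
rewrite -[ltLHS](real_normK (num_real _)) -[ltRHS](real_normK (num_real _)) ltr_sqr ?nnegrE//.
rewrite [ltRHS]normrM normr_nat norm_sin_mul_lt//.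
by apply: contra cs => /eqP s0; rewrite eq_sym -subr_eq0 onem_cosE s0 expr0n mulr0.
Qed.

End shifted_coefficients.

(** * Integration by parts for absolutely continuous functions *)

Section derivative_coefficients.
Context {R : realType}.
Notation mu := (@lebesgue_measure R).
Implicit Types f g h : R -> R.

Lemma lipschitz_of_derive (F f : R -> R) (L : R) :
  (forall x : R, is_derive x (1 : R) F (f x)) -> (forall x, `|f x| <= L) ->
  forall x y, `|F y - F x| <= L * `|y - x|.
Proof.
move=> dF fL x y.
have cF : continuous F.
  by move=> z; apply: differentiable_continuous; apply/derivable1_diffP; exact: ex_derive.
wlog xy : x y / x <= y => [H|].
  by have [/H//|/ltW/H] := leP x y; rewrite distrC [`|x - y|]distrC.
have [c _ ->] := MVT_segment xy (fun z _ => dF z) (continuous_subspaceT cF).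
by rewrite normrM ler_wpM2r.
Qed.

(** An increment of [f * h] splits into one of [f], weighted by at most [N], and one of [h], at most
    [M * L] times the length. Each part gets [e / 2]; the [+ 1] in the denominators covers [N = 0]
    and [M * L = 0]. *)
Lemma ac_onM_lipschitz f h (a b L M N : R) : a <= b -> ac_on a b f ->
  (forall x, a <= x <= b -> `|f x| <= M) -> (forall x, `|h x| <= N) ->
  (forall x y, `|h y - h x| <= L * `|y - x|) ->
  ac_on a b (fun x => f x * h x).
Proof.
move=> ab acf fM hN hL e e0.
have M0 : 0 <= M by apply: le_trans (fM a _); rewrite ?lexx.
have N0 : 0 <= N by exact: le_trans (hN 0).
have L0 : 0 <= L.
  by have := hL 0 1; rewrite subr0 normr1 mulr1; exact: le_trans.
have e10 : 0 < e / (2 * (N + 1)) by rewrite divr_gt0// mulr_gt0// ltr_pwDr.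
have [d d0 H] := acf _ e10.
pose d2 := e / (2 * (M * L + 1)).
have d20 : 0 < d2 by rewrite divr_gt0// mulr_gt0// ltr_pwDr// mulr_ge0.
exists (Num.min d d2) => [|I u v uv tI]; first by rewrite lt_min d0.
rewrite lt_min => /andP[/(H _ _ _ uv tI) h1 h2].
apply: (@le_lt_trans _ _ (N * \sum_i `|f (v i) - f (u i)| + M * L * \sum_i (v i - u i))).
  rewrite !mulr_sumr -big_split; apply: ler_sum => i _ /=.
  have [au [uvi vb]] := uv i.
  rewrite [X in `|X|](_ : _ = (f (v i) - f (u i)) * h (v i) + f (u i) * (h (v i) - h (u i)));
    last by ring.
  apply: (le_trans (ler_normD _ _)); rewrite !normrM; apply: lerD.
    by rewrite mulrC ler_wpM2r.
  rewrite -mulrA; apply: ler_pM => //.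
    by apply: fM; rewrite au (le_trans uvi).
  by apply: (le_trans (hL _ _)); rewrite ger0_norm ?subr_ge0.
rewrite [e]splitr; apply: ltrD.
  apply: (@le_lt_trans _ _ (N * (e / (2 * (N + 1))))); first exact/ler_wpM2l/ltW.
  rewrite -subr_gt0 (_ : _ - _ = e / (2 * (N + 1))); first by [].
  by field; lra.
apply: (@le_lt_trans _ _ (M * L * d2)); first by apply: ler_wpM2l; [exact: mulr_ge0|exact: ltW].
rewrite -subr_gt0 (_ : _ - _ = e / (2 * (M * L + 1))); first by [].
have : 0 <= M * L by exact: mulr_ge0.
by move=> ?; rewrite /d2; field; lra.
Qed.

(** The endpoints, about which [ac_derivative] is silent, form a null set. *)
Lemma ae_one_period (P : R -> Prop) :
  {ae mu, forall x, 0 < x < 2 * pi -> P x} ->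
  {ae mu, forall x, one_period R x -> P x}.
Proof.
move=> aeP.
have n0 : mu.-negligible [set (0 : R)].
  by apply/negligibleP; [exact: measurable_set1|exact: lebesgue_measure_set1].
have n2 : mu.-negligible [set (2 * pi : R)].
  by apply/negligibleP; [exact: measurable_set1|exact: lebesgue_measure_set1].
have F : Filter (nbhs (almost_everywhere mu)) by exact: ae_filter_ringOfSetsType.
have a0 : {ae mu, forall x, x != (0 : R)}.
  by apply: negligibleS n0 => x /= /negP; rewrite negbK => /eqP.
have a2 : {ae mu, forall x, x != (2 * pi : R)}.
  by apply: negligibleS n2 => x /= /negP; rewrite negbK => /eqP.
near=> x => xp.
have : 0 < x < 2 * pi.
  have : x != 0 by near: x; exact: a0.
  have : x != 2 * pi by near: x; exact: a2.
  move: xp; rewrite /one_period /= in_itv /= => /andP[x0 x2] xn2 xn0.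
  by rewrite !lt_neqAle x0 x2 eq_sym xn0 xn2.
by near: x; exact: aeP.
Unshelve. all: by end_near. Qed.

Lemma circint_by_parts f g h dh (L N : R) :
  periodic f (2 * pi) -> ac_on 0 (2 * pi) f -> cintegrable g ->
  {ae mu, forall x, 0 < x < 2 * pi -> derivable f x 1 /\ derive1 f x = g x} ->
  periodic h (2 * pi) -> (forall x : R, is_derive x (1 : R) h (dh x)) -> continuous dh ->
  (forall x, `|h x| <= N) -> (forall x, `|dh x| <= L) ->
  cintegrable (fun t => g t * h t) ->
  circint (fun t => g t * h t) = - circint (fun t => f t * dh t).
Proof.
move=> pf acf ig fg ph dhP cdh hN dhL igh.
have tp0 := @twopi_gt0 R.
have cf := unif_continuous_fun (unif_circle pf acf).
have hL := lipschitz_of_derive dhP dhL.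
have cnf : continuous (fun t => `|f t|) by move=> t; exact: cvg_norm (cf t).
have [u _ Hu] := EVT_max (ltW tp0) (continuous_subspaceT cnf).
have acfh : ac_on 0 (2 * pi) (fun x => f x * h x).
  apply: (ac_onM_lipschitz (M := `|f u|) _ acf _ hN hL); first exact: ltW.
  by move=> x x02; apply: Hu; rewrite in_itv.
have [k [ik kE fk]] := ac_derivative tp0 acfh.
apply/eqP; rewrite -subr_eq0 opprK -circintD//; last first.
  exact/continuous_cintegrable/continuous_funM.
(* [k] is almost everywhere the derivative of [f * h], and its integral is the increment of this
   periodic function over a period. *)
have -> : 0 = circint k.
  rewrite /circint kE -{1}[2 * pi]add0r pf -{1}[2 * pi]add0r ph; ring.
apply/eqP; rewrite /circint /Rintegral; congr fine.
have ifh : cintegrable (fun t => f t * dh t) by exact/continuous_cintegrable/continuous_funM.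
apply: ae_eq_integral; [exact: measurable_one_period| | |].
- by apply: (measurable_int mu); exact: (cintegrableD igh ifh).
- exact: (measurable_int mu ik).
have F : Filter (nbhs (almost_everywhere mu)) by exact: ae_filter_ringOfSetsType.
apply: (ae_one_period (P := fun x => (g x * h x + f x * dh x)%:E = (k x)%:E)).
near=> x => x02.
have [df f'] : derivable f x 1 /\ derive1 f x = g x by move: x02; near: x; exact: fg.
have [dfh <-] : derivable (fun x => f x * h x) x 1 /\ derive1 (fun x => f x * h x) x = k x.
  by move: x02; near: x; exact: fk.
congr EFin; have dfx : is_derive x (1 : R) f (g x).
  by rewrite -f' derive1E; exact/derivableP.
have := is_deriveM dfx (dhP x) => -[_]; rewrite derive1E => ->.
by rewrite /GRing.scale /= mulrC addrC mulrC; ring.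
Unshelve. all: by end_near. Qed.

End derivative_coefficients.

(** * The scalar case *)

Section scalar_inequality.
Context {R : realType}.
Notation mu := (@lebesgue_measure R).
Variables (f g : R -> R).
Hypotheses (pf : periodic f (2 * pi)) (acf : ac_on 0 (2 * pi) f)
  (ig : cintegrable g) (ig2 : cintegrable (fun t => g t ^+ 2))
  (fg : {ae mu, forall x, 0 < x < 2 * pi -> derivable f x 1 /\ derive1 f x = g x}).

Let uf : unif f. Proof. exact: unif_circle. Qed.
Let cf : continuous f. Proof. exact: unif_continuous_fun. Qed.

Lemma coefc_derive k : coefc g k = k%:R * coefs f k.
Proof.
have cdh : continuous (fun t : R => - k%:R * sin (k%:R * t)).
  by apply: continuous_funM; [exact: continuous_fun_cst|exact: continuous_sinM].
have -> : coefc g k = - circint (fun t => f t * (- k%:R * sin (k%:R * t))).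
  apply: (@circint_by_parts R f g (fun t => cos (k%:R * t)) _ k%:R 1 pf acf ig fg _ _ cdh).
  - exact: periodic_cosn.
  - by move=> x; rewrite mulNr; exact: is_derive_cosM.
  - by move=> x; exact: cos_max.
  - by move=> x; rewrite normrM normrN normr_nat -[leRHS]mulr1 ler_wpM2l//; exact: sin_max.
  - exact: cintegrable_coefc.
rewrite /coefs -circintZ; last exact/cintegrable_coefs/continuous_cintegrable.
rewrite -[LHS]mulN1r -circintZ; last exact/continuous_cintegrable/continuous_funM.
by congr circint; apply/funext => t; ring.
Qed.

Lemma coefs_derive k : coefs g k = - (k%:R * coefc f k).
Proof.
have cdh : continuous (fun t : R => k%:R * cos (k%:R * t)).
  by apply: continuous_funM; [exact: continuous_fun_cst|exact: continuous_cosM].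
have -> : coefs g k = - circint (fun t => f t * (k%:R * cos (k%:R * t))).
  apply: (@circint_by_parts R f g (fun t => sin (k%:R * t)) _ k%:R 1 pf acf ig fg _ _ cdh).
  - exact: periodic_sinn.
  - by move=> x; exact: is_derive_sinM.
  - by move=> x; exact: sin_max.
  - by move=> x; rewrite normrM normr_nat -[leRHS]mulr1 ler_wpM2l//; exact: cos_max.
  - exact: cintegrable_coefs.
rewrite /coefc -circintZ; last exact/cintegrable_coefc/continuous_cintegrable.
by congr (- circint _); apply/funext => t; ring.
Qed.

Lemma coef_sqr_derive k : coefc g k ^+ 2 + coefs g k ^+ 2 =
  k%:R ^+ 2 * (coefc f k ^+ 2 + coefs f k ^+ 2).
Proof. by rewrite coefc_derive coefs_derive; ring. Qed.

Variable s : R.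
Let D (t : R) := f (t + s) - f t.

Let pD : periodic D (2 * pi).
Proof. by move=> t; rewrite /D addrAC !pf. Qed.

Let uD : unif D. Proof. exact: unif_shiftB. Qed.

Let cfs : continuous (fun t => f (t + s)). Proof. exact: continuous_funT. Qed.

(** Removes the constant term from Parseval for [D]; [energy g] has nothing to compare it with. *)
Let D0 : circint D = 0.
Proof.
rewrite circintB ?circint_shift ?subrr//; exact: continuous_cintegrable.
Qed.

Let coefD k : coefc D k ^+ 2 + coefs D k ^+ 2 <=
  2 * (1 - cos s) * (coefc g k ^+ 2 + coefs g k ^+ 2).
Proof.
rewrite coef_sqr_shiftB// coef_sqr_derive mulrA ler_wpM2r ?addr_ge0 ?sqr_ge0//.
have := onem_cos_mul_le k s; set x := k%:R ^+ 2; nra.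
Qed.

Lemma energy_shiftB_le n : energy D n <= 2 * (1 - cos s) * energy g n.
Proof. by rewrite mulr_sumr; apply: ler_sum. Qed.

Let c0 : 0 <= 2 * (1 - cos s). Proof. by rewrite mulr_ge0// subr_ge0 cos_le1. Qed.

Lemma circint_shiftB_le :
  circint (fun t => D t ^+ 2) <= 2 * (1 - cos s) * circint (fun t => g t ^+ 2).
Proof.
have pi0 := @pi_gt0 R; apply/ler_addgt0Pr => e e0.
have [N HN] := parseval_le pD uD e0.
apply: (le_trans (HN N (leqnn N))); rewrite D0 expr0n mulr0 add0r lerD2r.
rewrite ler_pdivrMl// (le_trans (energy_shiftB_le N))// mulrCA.
by rewrite ler_wpM2l// bessel.
Qed.

(** A nonzero coefficient at [j] would make the termwise comparison of [energy D n] with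
    [energy g n] strict by [pi * d], uniformly in [n >= j], contradicting Parseval with error
    [d / 2] together with Bessel and the assumed equality. *)
Lemma circint_shiftB_eq_coef j : cos s != 1 ->
  circint (fun t => D t ^+ 2) = 2 * (1 - cos s) * circint (fun t => g t ^+ 2) ->
  (1 < j)%N -> coefc f j ^+ 2 + coefs f j ^+ 2 = 0.
Proof.
move=> cs E j1; have pi0 := @pi_gt0 R.
apply/eqP; rewrite eq_le addr_ge0 ?sqr_ge0// andbT leNgt; apply/negP => q0.
set q := coefc f j ^+ 2 + coefs f j ^+ 2 in q0.
pose d := pi^-1 * (2 * (j%:R ^+ 2 * (1 - cos s) - (1 - cos (j%:R * s))) * q).
have d0 : 0 < d.
  rewrite mulr_gt0 ?invr_gt0// mulr_gt0// mulr_gt0// subr_gt0.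
  exact: onem_cos_mul_lt.
have d20 : 0 < d / 2 by rewrite divr_gt0.
have [N HN] := parseval_le pD uD d20.
pose n := maxn N j.
(* [energy] lists frequency [k.+1] at index [k], so frequency [j] sits at [j.-1]. *)
have jn : (j.-1 < n)%N by rewrite /n prednK ?leq_maxr// ltnW.
have jE : (Ordinal jn).+1 = j by rewrite /= prednK// ltnW.
have := HN n (leq_maxl _ _); rewrite D0 expr0n mulr0 add0r => h.
have gap : energy D n <= 2 * (1 - cos s) * energy g n - pi * d.
  rewrite /energy mulr_sumr (bigD1 (Ordinal jn))//= [in leRHS](bigD1 (Ordinal jn))//=.
  rewrite -[j.-1.+1]/((Ordinal jn).+1) jE [leRHS]addrAC; apply: lerD; last by apply: ler_sum.
  rewrite coef_sqr_shiftB// coef_sqr_derive -/q /d mulVKf ?gt_eqF//.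
  by rewrite le_eqVlt; apply/orP; left; apply/eqP; ring.
have := bessel n ig ig2 => /(ler_wpM2l c0) hb.
have : pi * circint (fun t => D t ^+ 2) <= energy D n + pi * (d / 2).
  by move: h; rewrite -(ler_pM2l pi0) mulrDr mulVKf ?gt_eqF.
rewrite E; have := mulr_gt0 pi0 d0; nra.
Qed.

(** Only frequencies 0 and 1 survive, so the Fourier sums are [A], then constantly [A + B]. Their
    means differ from [A + B] by [B / n.+1] and converge to [f t]. *)
Lemma circint_shiftB_eq : cos s != 1 ->
  circint (fun t => D t ^+ 2) = 2 * (1 - cos s) * circint (fun t => g t ^+ 2) ->
  exists a0 a b : R, forall t, f t = a0 + cos t * a + sin t * b.
Proof.
move=> cs E; have pi0 := @pi_gt0 R.
pose A := (2 * pi)^-1 * circint f.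
exists A, (pi^-1 * coefc f 1), (pi^-1 * coefs f 1) => t.
pose B := pi^-1 * (coefc f 1 * cos t + coefs f 1 * sin t).
rewrite -addrA (_ : _ + _ * _ = B); last by rewrite /B; ring.
have cz j : (1 < j)%N -> coefc f j = 0 /\ coefs f j = 0.
  move=> /(circint_shiftB_eq_coef cs E) /eqP.
  by rewrite paddr_eq0 ?sqr_ge0// !sqrf_eq0 => /andP[/eqP ? /eqP ?].
have S0 : fourier_sum 0 f t = A by rewrite /fourier_sum big_ord0 mulr0 addr0.
have SE m : fourier_sum m.+1 f t = A + B.
  rewrite /fourier_sum big_ord_recl big1 => [|i _].
    by rewrite mul1r addr0.
  by have [-> ->] := cz (lift ord0 i).+1 isT; rewrite !mul0r addr0.
have FE n : fejer_sum n.+1 f t = A + B - n.+1%:R^-1 * B.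
  rewrite /fejer_sum big_ord_recl S0 (eq_bigr (fun=> A + B)) => [|i _]; last exact: SE.
  rewrite sumr_const card_ord -[(A + B) *+ n]mulr_natl.
  have n1 : n.+1%:R != 0 :> R by rewrite pnatr_eq0.
  have -> : n%:R = n.+1%:R - 1 :> R by rewrite -natr1 addrK.
  by field.
apply/eqP; rewrite -subr_eq0 -normr_le0; apply/ler_addgt0Pr => e e0; rewrite add0r.
have e20 : 0 < e / 2 by rewrite divr_gt0.
have [C C0 HC] := unif_kernel_bound pf uf e20.
(* Makes [C / n.+1], the error of [fejer_approx], and [|B| / n.+1], the effect of the first Fourier
   sum, at most [e / 2] together. *)
pose n := Num.bound ((C + `|B|) / (e / 2)).
have n0 : 0 < (n.+1%:R : R) by rewrite ltr0n.
have Cn : (C + `|B|) / n.+1%:R <= e / 2.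
  rewrite ler_pdivrMr// mulrC -ler_pdivrMr//.
  apply: (@le_trans _ _ n%:R); last by rewrite ler_nat.
  by apply/ltW/archi_boundP; rewrite divr_ge0 ?addr_ge0// ltW.
have := @fejer_approx R f (e / 2) C n.+1 t cf isT C0 (HC t).
rewrite FE => h.
rewrite (_ : f t - _ = f t - (A + B - n.+1%:R^-1 * B) - n.+1%:R^-1 * B); last by ring.
apply: (le_trans (ler_normB _ _)); rewrite normrM ger0_norm ?invr_ge0 ?(ltW n0)//.
move: Cn; rewrite mulrDl => Cn; rewrite [n.+1%:R^-1 * `|B|]mulrC.
apply: le_trans (lerD h (lexx _)) _.
by rewrite -addrA [leRHS]splitr lerD2l.
Qed.

End scalar_inequality.

(** * The cases in which equality holds *)

Section scalar_converse.
Context {R : realType}.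
Notation mu := (@lebesgue_measure R).

(** For such [f] the increment is a multiple of a translated derivative, [f (t + s) - f t = 2 * sin
    (s / 2) * h (t + s / 2)] with [h] the derivative of [f]; translation invariance finishes. *)
Lemma circint_shiftB_trig (f g : R -> R) (a0 a b s : R) : cintegrable g ->
  {ae mu, forall x, 0 < x < 2 * pi -> derivable f x 1 /\ derive1 f x = g x} ->
  (forall t, f t = a0 + cos t * a + sin t * b) ->
  circint (fun t => (f (t + s) - f t) ^+ 2) =
  2 * (1 - cos s) * circint (fun t => g t ^+ 2).
Proof.
move=> ig fg fE; pose h (t : R) := b * cos t - a * sin t.
have ch : continuous h.
  apply: continuous_funB; apply: continuous_funM;
    by [exact: continuous_fun_cst|exact: continuous_cos|exact: continuous_sin].
have ph : periodic h (2 * pi).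
  by move=> t; rewrite /h mulr_natl cosD2pi sinD2pi.
have dfh (x : R) : is_derive x (1 : R) f (h x).
  have -> : f = (cst a0 + a *: cos + b *: sin)%R.
    by apply/funext => t; rewrite fE !fctE /GRing.scale /=; ring.
  have d1 := is_deriveD (is_derive_cst a0 x (1 : R)) (is_deriveZ a (is_derive_cos x)).
  have := is_deriveD d1 (is_deriveZ b (is_derive_sin x)).
  by rewrite /GRing.scale /= (_ : 0 + a * - sin x + b * cos x = h x)//; rewrite /h; ring.
have gE : circint (fun t => g t ^+ 2) = circint (fun t => h t ^+ 2).
  rewrite /circint /Rintegral; congr fine.
  apply: ae_eq_integral; [exact: measurable_one_period| | |].
  - apply/measurable_EFinP; apply: measurable_funX.
    by apply/measurable_EFinP; exact: (measurable_int mu ig).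
  - apply: (measurable_int mu); apply: continuous_cintegrable.
    exact: continuous_funX.
  have F : Filter (nbhs (almost_everywhere mu)) by exact: ae_filter_ringOfSetsType.
  apply: (ae_one_period (P := fun x => (g x ^+ 2)%:E = (h x ^+ 2)%:E)).
  apply: filterS fg => x /[apply] -[_ <-].
  by rewrite derive1E derive_val.
rewrite gE.
have -> : (fun t => (f (t + s) - f t) ^+ 2) =
    (fun t => 2 * (1 - cos s) * h (t + s / 2) ^+ 2).
  apply/funext => t; rewrite !fE /h onem_cosE; set r := s / 2.
  have [u ->] : exists u, t = u - r by exists (t + r); rewrite addrK.
  have -> : u - r + s = u + r by rewrite /r; field.
  rewrite subrK !cosD !sinD cosN sinN; ring.
rewrite circintZ; last first.
  by apply: continuous_cintegrable; apply: continuous_funX; exact: continuous_funT.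
congr (_ * _); apply: (circint_shift (f := fun t => h t ^+ 2)).
  exact: continuous_funX.
by move=> t; rewrite ph.
Qed.

(** On []0, pi]] the cosine is below 1 by monotonicity; residues beyond [pi] are reflected to
    [2 * pi - r]. *)
Lemma cos_eq1 (s : R) : cos s = 1 <-> exists k : int, s = k%:~R * (2 * pi).
Proof.
have pi0 := @pi_gt0 R; split => [|[k ->]]; last first.
  by rewrite -[_ * _]add0r cos_periodic_int cos0.
have [k /andP[k1 k2]] := reduce_modulo s (@twopi_gt0 R).
rewrite -(cos_periodic_int (- k)) mulrNz mulNr.
set r := s - _ in k1 k2 *; move=> c1; exists k; apply/eqP; rewrite -subr_eq0 -/r.
have c2 : cos (2 * pi - r) = 1.
  rewrite -cosN opprB -[RHS]c1 -[LHS]cosD2pi; congr cos.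
  by rewrite -[pi *+ 2]mulr_natl subrK.
apply/negPn/negP => r0; have {r0}r0 : 0 < r by rewrite lt_neqAle eq_sym r0.
have lt1 (x : R) : 0 < x -> x <= pi -> cos x < 1.
  by move=> x0 xpi; rewrite -[ltRHS]cos0 ltr_cos// in_itv /= ?lexx ?(ltW x0)//= ltW.
have [rpi|pir] := leP r pi; first by have := lt1 r r0 rpi; rewrite c1 ltxx.
have : cos (2 * pi - r) < 1 by apply: lt1; lra.
by rewrite c2 ltxx.
Qed.

End scalar_converse.

(** * Reduction to coordinates *)

Section euclidean_norm.
Context {R : realType} {n : nat}.
Implicit Types v : 'rV[R]_n.

Lemma enorm_sqr v : enorm v ^+ 2 = \sum_(i < n) v 0 i ^+ 2.
Proof. by rewrite sqr_sqrtr// sumr_ge0// => i _; exact: sqr_ge0. Qed.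

Lemma norm_coord_le_enorm v i : `|v 0 i| <= enorm v.
Proof.
rewrite -(@ler_sqr _ `|v 0 i|) ?nnegrE ?sqrtr_ge0//.
rewrite (real_normK (num_real _)) enorm_sqr (bigD1 i)//= lerDl.
by apply: sumr_ge0 => j _; exact: sqr_ge0.
Qed.

(** [abs_continuous] asks for nondegenerate intervals indexed by ordinals. Degenerate ones add
    nothing to either sum, so they are dropped ([A] selects the others) and the rest is
    enumerated. *)
Lemma abs_continuous_coord (u v : R) (f : R -> 'rV[R]_n) i :
  abs_continuous u v f -> ac_on u v (fun t => f t 0 i).
Proof.
move=> acf e e0; have [d d0 H] := acf _ e0; exists d => // I a b ab tI sd.
pose A := [pred k | a k < b k].
have disc k : ~~ A k -> a k = b k.
  by rewrite /= -leNgt => ba; apply/eqP; rewrite eq_le ba andbT; have [_ []] := ab k.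
pose a' (j : 'I_#|A|) := a (enum_val j); pose b' (j : 'I_#|A|) := b (enum_val j).
have sumA (F : I -> R) : (forall k, ~~ A k -> F k = 0) ->
    \sum_k F k = \sum_(j < #|A|) F (enum_val j).
  by move=> F0; rewrite -(big_enum_val F) /= (bigID A)/= [X in _ + X]big1 ?addr0//.
rewrite sumA => [|k /disc ->]; last by rewrite subrr normr0.
apply: (@le_lt_trans _ _ (\sum_(j < #|A|) enorm (f (b' j) - f (a' j)))).
  apply: ler_sum => j _; apply: le_trans (norm_coord_le_enorm _ i).
  by rewrite !mxE.
apply: H => [j|j k _ _ jk|].
- have [h1 [h2 h3]] := ab (enum_val j); split => //; split => //.
  exact: (enum_valP j).
- by apply/enum_val_inj/tI.
- by move: sd; rewrite sumA// => k /disc ->; rewrite subrr.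
Qed.

End euclidean_norm.

Lemma EFin_circint (R : realType) (f : R -> R) : cintegrable f ->
  ((circint f)%:E = \int[@lebesgue_measure R]_(t in one_period R) (f t)%:E)%E.
Proof.
move=> intf; rewrite /circint /Rintegral fineK//.
by apply: integrable_fin_num => //; exact: measurable_one_period.
Qed.

Section coordinates.
Context {R : realType} {n : nat}.
Variable c : R -> 'rV[R]_n.
Hypotheses (c_ac : circle_abs_continuous c) (c_sq : deriv_square_integrable c).
Notation mu := (@lebesgue_measure R).

Lemma periodic_coord i : periodic (fun t => c t 0 i) (2 * pi).
Proof. by move=> t; rewrite c_ac.1. Qed.

Lemma ac_on_coord i : ac_on 0 (2 * pi) (fun t => c t 0 i).
Proof. exact: abs_continuous_coord c_ac.2. Qed.

(** Almost everywhere all coordinates are differentiable at once, hence so is [c], and the sum [S]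
    of the [g i t ^+ 2] agrees with the squared norm of its derivative. Thus [S] inherits
    integrability from [c_sq] and dominates each summand. *)
Lemma derivative_coords : exists g : 'I_n -> R -> R,
  [/\ forall i, cintegrable (g i), forall i, cintegrable (fun t => g i t ^+ 2),
  forall i, {ae mu, forall x, 0 < x < 2 * pi ->
    derivable (fun t => c t 0 i) x 1 /\ derive1 (fun t => c t 0 i) x = g i x} &
  (\int[mu]_(t in one_period R) (enorm (derive1 c t) ^+ 2)%:E =
    (\sum_i circint (fun t => g i t ^+ 2))%:E)%E].
Proof.
have /choice[g gP] i := ac_derivative (@twopi_gt0 R) (ac_on_coord i).
have ig i : cintegrable (g i) by have [] := gP i.
have aeg i : {ae mu, forall x, 0 < x < 2 * pi ->
    derivable (fun t => c t 0 i) x 1 /\ derive1 (fun t => c t 0 i) x = g i x}.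
  by have [] := gP i.
have F : Filter (nbhs (almost_everywhere mu)) by exact: ae_filter_ringOfSetsType.
have mg i : measurable_fun (one_period R) (g i).
  by apply/measurable_EFinP; exact: (measurable_int mu (ig i)).
have mg2 i : measurable_fun (one_period R) (fun t => g i t ^+ 2).
  exact: measurable_funX.
pose S t := \sum_i g i t ^+ 2.
have mS : measurable_fun (one_period R) S.
  exact: measurable_sum.
have aeS : {ae mu, forall x, one_period R x -> (S x)%:E = (enorm (derive1 c x) ^+ 2)%:E}.
  apply: ae_one_period.
  have : {ae mu, forall x i, 0 < x < 2 * pi ->
      derivable (fun t => c t 0 i) x 1 /\ derive1 (fun t => c t 0 i) x = g i x}.
    exact: filter_forall.
  apply: filterS => x H x02; congr EFin.
  have dc : derivable c x 1.
    apply/derivable_mxP => j i; have [] := H i x02.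
    by rewrite (ord1 j).
  rewrite enorm_sqr derive1E derive_mx//; apply: eq_bigr => i _.
  by rewrite mxE -derive1E; have [_ ->] := H i x02.
have mE : measurable_fun (one_period R) (fun t => (enorm (derive1 c t) ^+ 2)%:E).
  exact: (measurable_int mu c_sq).
have S0 t : 0 <= S t by apply: sumr_ge0 => i _; exact: sqr_ge0.
have iS : cintegrable S.
  apply/integrableP; split; first exact/measurable_EFinP.
  rewrite (@ae_eq_integral _ _ _ mu _ (fun t => `|(enorm (derive1 c t) ^+ 2)%:E|%E)).
  - by have /integrableP[] := c_sq.
  - exact: measurable_one_period.
  - by apply: measurableT_comp => //; exact/measurable_EFinP.
  - by apply: measurableT_comp.
  - by apply: filterS aeS => x H xp; rewrite -(H xp).
have ig2 i : cintegrable (fun t => g i t ^+ 2).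
  apply: (@le_integrable _ _ R mu (one_period R) _ (EFin \o (fun t => g i t ^+ 2)) (EFin \o S)).
  - exact: measurable_one_period.
  - by apply/measurable_EFinP; exact: mg2.
  - move=> t _; rewrite /= lee_fin !ger0_norm ?sqr_ge0//.
    by rewrite /S (bigD1 i)//= lerDl sumr_ge0// => j _; exact: sqr_ge0.
  - exact: iS.
exists g; split => //.
rewrite -circint_sum// EFin_circint//.
apply: ae_eq_integral => //; first exact: measurable_one_period.
  exact/measurable_EFinP.
by apply: filterS aeS => x /[apply] ->.
Qed.

Lemma integral_shiftB (s : R) :
  (\int[mu]_(t in one_period R) (enorm (c (t + s) - c t) ^+ 2)%:E =
  (\sum_i circint (fun t => (c (t + s) 0 i - c t 0 i) ^+ 2))%:E)%E.
Proof.
have cc i : continuous (fun t => (c (t + s) 0 i - c t 0 i) ^+ 2).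
  have cf := unif_continuous_fun (unif_circle (periodic_coord i) (ac_on_coord i)).
  apply: (@continuous_funX _ (fun t => c (t + s) 0 i - c t 0 i)).
  by apply: continuous_funB => //; exact: (@continuous_funT _ (fun t => c t 0 i)).
have iS : cintegrable (fun t => \sum_i (c (t + s) 0 i - c t 0 i) ^+ 2).
  by apply: cintegrable_sum => i; exact: continuous_cintegrable.
rewrite -circint_sum; last by move=> i; exact: continuous_cintegrable.
rewrite EFin_circint//.
apply: eq_integral => t _; congr EFin; rewrite enorm_sqr.
by apply: eq_bigr => i _; rewrite !mxE.
Qed.

End coordinates.

Lemma lam_sqr (R : realType) (s : R) : lam s ^+ 2 = 2 * (1 - cos s).
Proof. by rewrite onem_cosE /lam; ring. Qed.


Unset Implicit Arguments.

Theorem theorem2p2 (R : realType) (n : nat) (c : R -> 'rV[R]_n)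
    (c_ac : circle_abs_continuous c)
    (c_sq : deriv_square_integrable c) (s : R) :
  (\int[@lebesgue_measure R]_(t in one_period R)
      (enorm (c (t + s) - c t) ^+ 2)%:E
   <= (lam s ^+ 2)%:E *
      \int[@lebesgue_measure R]_(t in one_period R)
        (enorm (derive1 c t) ^+ 2)%:E)%E
  /\
  ((\int[@lebesgue_measure R]_(t in one_period R)
      (enorm (c (t + s) - c t) ^+ 2)%:E
    = (lam s ^+ 2)%:E *
      \int[@lebesgue_measure R]_(t in one_period R)
        (enorm (derive1 c t) ^+ 2)%:E)%E
   <->
   (exists k : int, s = k%:~R * (2 * pi)) \/
   (exists a0 a b : 'rV[R]_n,
      forall t : R, c t = a0 + cos t *: a + sin t *: b)).
Proof.
have [g [ig ig2 fg ->]] := derivative_coords c_ac c_sq.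
have pf := periodic_coord c_ac; have acf := ac_on_coord c_ac.
rewrite integral_shiftB// -EFinM lee_fin lam_sqr mulr_sumr.
have le_i i : circint (fun t => (c (t + s) 0 i - c t 0 i) ^+ 2) <=
    2 * (1 - cos s) * circint (fun t => g i t ^+ 2).
  exact: (circint_shiftB_le (pf i) (acf i) (ig i) (ig2 i) (fg i)).
split; first by apply: ler_sum => i _; exact: le_i.
split => [[E]|].
  have [c1|c1] := eqVneq (cos s) 1; [left; exact/cos_eq1|right].
  (* The coordinatewise deficits are nonnegative and add up to 0, so each of them vanishes. *)
  have eq_i i : circint (fun t => (c (t + s) 0 i - c t 0 i) ^+ 2) =
      2 * (1 - cos s) * circint (fun t => g i t ^+ 2).
    apply/esym/eqP; rewrite -subr_eq0; apply/eqP.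
    apply: (psumr_eq0P (P := xpredT)
      (F := fun i => 2 * (1 - cos s) * circint (fun t => g i t ^+ 2) -
        circint (fun t => (c (t + s) 0 i - c t 0 i) ^+ 2))) => //.
      by move=> j _; rewrite subr_ge0.
    by rewrite sumrB E subrr.
  have /choice[a0 /choice[a /choice[b cE]]] : forall i, exists a0 a b : R, forall t,
      c t 0 i = a0 + cos t * a + sin t * b.
    move=> i.
    exact: (circint_shiftB_eq (pf i) (acf i) (ig i) (ig2 i) (fg i) c1 (eq_i i)).
  exists (\row_i a0 i), (\row_i a i), (\row_i b i) => t.
  by apply/rowP => i; rewrite !mxE cE.
case=> [/cos_eq1 c1|[a0 [a [b cE]]]]; congr EFin; apply: eq_bigr => i _.
  (* If [cos s = 1], the right-hand side is 0 and the inequality squeezes the left-hand side to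
     0. *)
  apply/eqP; rewrite eq_le le_i c1 subrr mulr0 mul0r circint_ge0// => t.
  exact: sqr_ge0.
apply: (circint_shiftB_trig (a0 := a0 0 i) (a := a 0 i) (b := b 0 i) s (ig i) (fg i)) => t.
by rewrite cE !mxE.
Qed.
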